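(* Let $N$ be a positive integer and let $\phi:\mathfrak{L}_{\geq N}\rightarrow\mathbb{C}$ be a Whittaker function (i.e. a Lie algebra homomorphism). Then the universal Whittaker $\mathfrak{L}$-module $W(\mathfrak{L}_{\geq N},\phi)$ is simple if and only if either $\phi_{2N}\notin\mathcal{E}$ or $\phi_{2N-1}\notin\mathcal{E}$.
   Context: All Lie algebras are over $\mathbb{C}$; $\mathbb{N}$ is the set of nonnegative integers. Let $\mathcal{A}=\mathbb{C}[t,t^{-1}]$. The Virasoro algebra $Vir$ has basis $\{\boldsymbol{c},\mathrm{d}_i\mid i\in\mathbb{Z}\}$ with $[\mathrm{d}_i,\mathrm{d}_j]=(j-i)\mathrm{d}_{i+j}+\delta_{i,-j}\frac{i^3-i}{12}\boldsymbol{c}$ and $[\mathrm{d}_i,\boldsymbol{c}]=0$. The loop Virasoro algebra is $\mathfrak{L}=Vir\otimes\mathcal{A}$ with $[\mathrm{d}_i\otimes t^k,\mathrm{d}_j\otimes t^l]=(j-i)\mathrm{d}_{i+j}\otimes t^{k+l}+\delta_{i,-j}\frac{i^3-i}{12}\boldsymbol{c}\otimes t^{k+l}$ and $\boldsymbol{c}\otimes\mathcal{A}$ central. Let $\mathfrak{L}_{\geq N}=\mathrm{Span}_{\mathbb{C}}\{\mathrm{d}_i\otimes t^k,\boldsymbol{c}\otimes t^k\mid i\geq N,\ k\in\mathbb{Z}\}$. For a Whittaker function $\phi$ and $n\geq N$, define $\phi_n\in\mathcal{A}^*$ by $\phi_n(t^r)=\phi(\mathrm{d}_n\otimes t^r)$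 for $r\in\mathbb{Z}$. The universal Whittaker module is $W(\mathfrak{L}_{\geq N},\phi)=\mathcal{U}(\mathfrak{L})\otimes_{\mathcal{U}(\mathfrak{L}_{\geq N})}\mathbb{C}v_\phi$, where $\mathbb{C}v_\phi$ is the one-dimensional $\mathfrak{L}_{\geq N}$-module with $x.v_\phi=\phi(x)v_\phi$. A linear functional $\chi\in\mathcal{A}^*$ is exp-polynomial if there is a finite sum expression $\chi(t^n)=\sum_{k\in\mathbb{N}}\sum_{\lambda\in\mathbb{C}^\times}c_{k,\lambda}n^k\lambda^n$ (finitely many nonzero $c_{k,\lambda}\in\mathbb{C}$, with $0^0=1$) valid for all $n\in\mathbb{Z}$; $\mathcal{E}\subseteq\mathcal{A}^*$ is the subspace of all exp-polynomial functionals. *)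

(* Defs.v *)
(* The complex numbers are R[i] for R : realType; Lie algebras,
   enveloping algebras and induced modules are set up over any field K. *)
From HB Require Import structures.
From mathcomp Require Import all_boot all_order all_algebra finmap.
From mathcomp Require Import generic_quotient ring_quotient.
From mathcomp Require Import complex boolp reals monalg.
From mathcomp Require Import ring zify lra.

Set Implicit Arguments.
Unset Strict Implicit.
Unset Printing Implicit Defensive.

Import GRing.Theory.
Local Open Scope ring_scope.
Local Open Scope quotient_scope.

Section LinearExtension.
Variables (K : nzRingType) (B : choiceType) (V : lmodType K).
Implicit Types (f : B -> V) (x y : {malg K[B]}).

Definition lin_ext f x : V := \sum_(b <- msupp x) x@_b *: f b.

Lemma lin_extw f x (d : {fset B}) :
  (msupp x `<=` d)%fset -> lin_ext f x = \sum_(b <- d) x@_b *: f b.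
Proof.
move=> le_xd; rewrite /lin_ext (big_fset_incl _ le_xd) // => b _ bNx.
by rewrite mcoeff_outdom ?scale0r.
Qed.

Lemma lin_ext_is_linear f : linear (lin_ext f).
Proof.
move=> a x y; pose d := (msupp (a *: x + y) `|` (msupp x `|` msupp y))%fset.
rewrite (@lin_extw _ _ d) ?(@lin_extw _ x d) ?(@lin_extw _ y d).
- rewrite scaler_sumr -big_split /=; apply: eq_bigr => b _.
  by rewrite mcoeffD mcoeffZ scalerDl scalerA.
- by apply/fsubsetP => b bx; rewrite !in_fsetU bx !orbT.
- by apply/fsubsetP => b bx; rewrite !in_fsetU bx !orbT.
by apply/fsubsetP => b bx; rewrite !in_fsetU bx.
Qed.

HB.instance Definition _ f :=
  GRing.isLinear.Build K {malg K[B]} V *:%R (lin_ext f) (lin_ext_is_linear f).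

Lemma lin_extZU f a b : lin_ext f << a *g b >> = a *: f b.
Proof.
rewrite (@lin_extw _ _ [fset b]%fset) ?msuppU_le //.
by rewrite big_seq_fset1 mcoeffUU.
Qed.

Lemma lin_extU f b : lin_ext f << b >> = f b.
Proof. by rewrite lin_extZU scale1r. Qed.

Lemma malg_lin_ext (x : {malg K[B]}) : x = \sum_(b <- msupp x) x@_b *: << b >>.
Proof.
rewrite [LHS]monalgE; apply: eq_bigr => b _.
by apply/malgP => k; rewrite mcoeffZ !mcoeffU mulrnAr mulr1.
Qed.

End LinearExtension.

Section Span.
Variables (R : pzRingType) (M : lmodType R) (X : M -> Prop).

Inductive in_span : M -> Prop :=
| in_span0 : in_span 0
| in_spanD a x y : X x -> in_span y -> in_span (a *: x + y).

Definition span : {pred M} := fun x => `[< in_span x >].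

Lemma spanP x : reflect (in_span x) (x \in span).
Proof. exact: asboolP. Qed.

Lemma span_submod_closed : submod_closed span.
Proof.
split; first exact/spanP/in_span0.
move=> a x y /spanP Xx /spanP Xy; apply/spanP.
elim: Xx => [|b u v Xu _ IH]; first by rewrite scaler0 add0r.
by rewrite scalerDr scalerA -addrA; apply: in_spanD.
Qed.

HB.instance Definition _ := GRing.isSubmodClosed.Build R M span span_submod_closed.

Lemma mem_span x : X x -> x \in span.
Proof.
move=> Xx; apply/spanP; rewrite -[x]addr0 -[x]scale1r.
exact/in_spanD/in_span0.
Qed.

End Span.

Section QuotientModule.
Variables (R : pzRingType) (M : lmodType R) (S : submodClosed M).

Fact submod_zmod_closed : zmod_closed S.
Proof.
by split=> [|x y Sx Sy]; rewrite ?rpred0 // -scaleN1r rpredD ?rpredZ.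
Qed.

Let S_zmod : {pred M} := S.
HB.instance Definition _ := GRing.isZmodClosed.Build M S_zmod submod_zmod_closed.

Definition lmod_quot := {ideal_quot S_zmod}.

HB.instance Definition _ := GRing.Zmodule.on lmod_quot.

Definition lmod_pi (x : M) : lmod_quot := \pi x.

Lemma lmod_piP x y : reflect (lmod_pi x = lmod_pi y) (x - y \in S).
Proof. by rewrite [_ \in _](@Quotient.idealrBE _ S_zmod); apply: eqP. Qed.

Lemma lmod_piK (u : lmod_quot) : lmod_pi (repr u) = u.
Proof. exact: reprK. Qed.

Lemma lmod_pi_zmod : zmod_morphism lmod_pi.
Proof. by move=> x y; rewrite /lmod_pi raddfB. Qed.

HB.instance Definition _ := GRing.isZmodMorphism.Build M lmod_quot lmod_pi lmod_pi_zmod.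

Definition lmod_quot_scale a (u : lmod_quot) : lmod_quot := lmod_pi (a *: repr u).

Lemma lmod_quot_scaleE a x : lmod_quot_scale a (lmod_pi x) = lmod_pi (a *: x).
Proof. by apply/lmod_piP; rewrite -scalerBr rpredZ //; apply/lmod_piP/lmod_piK. Qed.

Fact lmod_quot_scalerA a b u :
  lmod_quot_scale a (lmod_quot_scale b u) = lmod_quot_scale (a * b) u.
Proof. by rewrite -[u]lmod_piK !lmod_quot_scaleE scalerA. Qed.

Fact lmod_quot_scale1r : left_id 1 lmod_quot_scale.
Proof. by move=> u; rewrite -[u]lmod_piK !lmod_quot_scaleE scale1r. Qed.

Fact lmod_quot_scalerDr : right_distributive lmod_quot_scale +%R.
Proof.
move=> a u v; rewrite -[u]lmod_piK -[v]lmod_piK -raddfD.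
by rewrite !lmod_quot_scaleE scalerDr raddfD.
Qed.

Fact lmod_quot_scalerDl u : {morph lmod_quot_scale^~ u : a b / a + b}.
Proof.
by move=> a b; rewrite -[u]lmod_piK !lmod_quot_scaleE scalerDl raddfD.
Qed.

HB.instance Definition _ := GRing.Zmodule_isLmodule.Build R lmod_quot
  lmod_quot_scalerA lmod_quot_scale1r lmod_quot_scalerDr lmod_quot_scalerDl.

Lemma lmod_pi_scalable : scalable lmod_pi.
Proof. by move=> a x; rewrite -lmod_quot_scaleE. Qed.

HB.instance Definition _ :=
  GRing.isScalable.Build R M lmod_quot *:%R lmod_pi lmod_pi_scalable.

End QuotientModule.

Definition simple_module (R : pzRingType) (M : lmodType R) : Prop :=
  (exists v : M, v != 0) /\
  forall S : {pred M}, submod_closed S -> S =i pred1 0 \/ S =i predT.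

HB.mixin Record Lmodule_isLieAlgebra (K : fieldType) g of GRing.Lmodule K g := {
  lie : g -> g -> g;
  lieDl : forall a x y z, lie (a *: x + y) z = a *: lie x z + lie y z;
  lieDr : forall a x y z, lie z (a *: x + y) = a *: lie z x + lie z y;
  liexx : forall x, lie x x = 0;
  lie_jacobi : forall x y z,
    lie x (lie y z) + lie y (lie z x) + lie z (lie x y) = 0
}.

#[short(type="lieType")]
HB.structure Definition LieAlgebra (K : fieldType) :=
  {g of GRing.Lmodule K g & Lmodule_isLieAlgebra K g}.

HB.mixin Record isLieMorphism (K : fieldType) (g h : lieType K) (f : g -> h) := {
  lie_morph : forall x y, f (lie x y) = lie (f x) (f y)
}.

#[short(type="lieMorphism")]
HB.structure Definition LieMorphism (K : fieldType) (g h : lieType K) :=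
  {f of isLieMorphism K g h f & @GRing.Linear K g h *:%R f}.

Notation "{ 'lie' g -> h }" := (@lieMorphism _ g%type h%type)
  (at level 0, g at level 98, h at level 99, format "{ 'lie'  g  ->  h }")
  : type_scope.

(* The field as a one-dimensional Lie algebra, which is abelian. *)
Section AbelianLine.
Variable K : fieldType.

Let lie0 (_ _ : K^o) : K^o := 0.

Fact lie0Dl a x y z : lie0 (a *: x + y) z = a *: lie0 x z + lie0 y z.
Proof. by rewrite /lie0 scaler0 addr0. Qed.

Fact lie0Dr a x y z : lie0 z (a *: x + y) = a *: lie0 z x + lie0 z y.
Proof. by rewrite /lie0 scaler0 addr0. Qed.

Fact lie0xx x : lie0 x x = 0. Proof. by []. Qed.

Fact lie0_jacobi x y z :
  lie0 x (lie0 y z) + lie0 y (lie0 z x) + lie0 z (lie0 x y) = 0.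
Proof. by rewrite /lie0 !addr0. Qed.

HB.instance Definition _ := Lmodule_isLieAlgebra.Build K K^o
  lie0Dl lie0Dr lie0xx lie0_jacobi.

End AbelianLine.

Section LieTheory.
Variables (K : fieldType) (g : lieType K).
Implicit Types x y z : g.

Lemma lie0x x : lie 0 x = 0.
Proof. by have := lieDl (-1) 0 0 x; rewrite scaler0 addr0 scaleN1r addNr. Qed.

Lemma liex0 x : lie x 0 = 0.
Proof. by have := lieDr (-1) 0 0 x; rewrite scaler0 addr0 scaleN1r addNr. Qed.

End LieTheory.

Section TwoSidedIdeal.
Variables (K : nzRingType) (A : lalgType K) (X : A -> Prop).

Inductive in_ideal : A -> Prop :=
| in_ideal0 : in_ideal 0
| in_idealD a x b y : X x -> in_ideal y -> in_ideal (a * x * b + y).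

Definition ideal_gen : {pred A} := fun x => `[< in_ideal x >].

Lemma ideal_genP x : reflect (in_ideal x) (x \in ideal_gen).
Proof. exact: asboolP. Qed.

Lemma ideal_genMl a x : x \in ideal_gen -> a * x \in ideal_gen.
Proof.
move=> /ideal_genP Xx; apply/ideal_genP.
elim: Xx => [|b u c v Xu _ IH]; first by rewrite mulr0; exact: in_ideal0.
by rewrite mulrDr !mulrA; apply: in_idealD.
Qed.

Lemma ideal_genMr a x : x \in ideal_gen -> x * a \in ideal_gen.
Proof.
move=> /ideal_genP Xx; apply/ideal_genP.
elim: Xx => [|b u c v Xu _ IH]; first by rewrite mul0r; exact: in_ideal0.
by rewrite mulrDl -mulrA; apply: in_idealD.
Qed.

Lemma ideal_gen_submod_closed : submod_closed ideal_gen.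
Proof.
split; first exact/ideal_genP/in_ideal0.
move=> a x y Xx /ideal_genP Xy.
have /ideal_genP: a%:A * x \in ideal_gen by apply: ideal_genMl.
rewrite mulr_algl => Xax; apply/ideal_genP.
elim: Xax => [|b u c v Xu _ IH]; first by rewrite add0r.
by rewrite -addrA; apply: in_idealD.
Qed.

HB.instance Definition _ :=
  GRing.isSubmodClosed.Build K A ideal_gen ideal_gen_submod_closed.

Lemma mem_ideal_gen x : X x -> x \in ideal_gen.
Proof.
move=> Xx; apply/ideal_genP; rewrite -[x]addr0 -[x]mul1r -[1 * x]mulr1.
exact/in_idealD/in_ideal0.
Qed.

End TwoSidedIdeal.

(* {malg K[{fmonom T}]} is the monoid algebra of the free monoid on T, i.e. the
   free associative unital algebra on T. *)
Section FreeAlgebra.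
Variables (K : fieldType) (T : choiceType).
Local Notation F := {malg K[{fmonom T}]}.

Definition free_gen (x : T) : F := << fmu x >>.

Lemma free_scalerAr a (u v : F) : a *: (u * v) = u * (a *: v).
Proof.
rewrite [u * v]malgME (malgMEw (fsubset_refl _) (msuppZ_le a v)) scaler_sumr.
apply: eq_bigr => m _; rewrite scaler_sumr; apply: eq_bigr => n _.
apply/malgP => k; rewrite mcoeffZ !mcoeffU mcoeffZ mulrnAr.
by rewrite mulrCA.
Qed.

Variables (A : algType K) (f : T -> A).

Definition free_monom (m : {fmonom T}) : A := \prod_(x <- fmonom_val m) f x.

Definition free_lift (u : F) : A := lin_ext free_monom u.

HB.instance Definition _ := GRing.Linear.copy free_lift (lin_ext free_monom).

Lemma free_lift_gen x : free_lift (free_gen x) = f x.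
Proof. by rewrite /free_lift lin_extU /free_monom /= fmU big_seq1. Qed.

Lemma free_lift_monoid : monoid_morphism free_lift.
Proof.
split=> [|u v]; first by rewrite /free_lift lin_extU /free_monom fm1 big_nil.
rewrite malgME linear_sum mulr_suml; apply: eq_bigr => m _.
rewrite linear_sum mulr_sumr; apply: eq_bigr => n _.
rewrite [LHS]lin_extZU /free_monom fmM big_cat /=.
by rewrite -scalerAl -scalerAr scalerA.
Qed.

HB.instance Definition _ :=
  GRing.isMonoidMorphism.Build F A free_lift free_lift_monoid.

Lemma free_liftB u v : free_lift (u - v) = free_lift u - free_lift v.
Proof. exact: raddfB. Qed.

Lemma free_liftD u v : free_lift (u + v) = free_lift u + free_lift v.
Proof. exact: raddfD. Qed.

Lemma free_liftZ a u : free_lift (a *: u) = a *: free_lift u.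
Proof. exact: linearZ_LR. Qed.

Lemma free_liftM u v : free_lift (u * v) = free_lift u * free_lift v.
Proof. exact: rmorphM. Qed.

Lemma free_lift1 : free_lift 1 = 1.
Proof. exact: rmorph1. Qed.

End FreeAlgebra.

Section UniversalEnveloping.
Variables (K : fieldType) (g : lieType K).
Local Notation F := {malg K[{fmonom g}]}.

(* Linearity makes the free algebra on the set g into the tensor algebra of the
   vector space g. *)
Variant uea_rel : F -> Prop :=
| uea_rel_linear a (x y : g) :
    uea_rel (free_gen K (a *: x + y) - (a *: free_gen K x + free_gen K y))
| uea_rel_lie (x y : g) :
    uea_rel (free_gen K x * free_gen K y - free_gen K y * free_gen K x
             - free_gen K (lie x y)).

Definition uea_ideal : submodClosed F := ideal_gen uea_rel.

Definition uea := lmod_quot uea_ideal.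

HB.instance Definition _ := GRing.Lmodule.on uea.

Definition uea_pi (u : F) : uea := lmod_pi uea_ideal u.

HB.instance Definition _ := GRing.Linear.copy uea_pi (lmod_pi uea_ideal).

Lemma uea_piK (u : uea) : uea_pi (repr u) = u.
Proof. exact: lmod_piK. Qed.

Lemma uea_piP u v : reflect (uea_pi u = uea_pi v) (u - v \in uea_ideal).
Proof. exact: lmod_piP. Qed.

Definition uea_mul : uea -> uea -> uea := locked (fun u v => uea_pi (repr u * repr v)).

Lemma uea_mulE u v : uea_mul (uea_pi u) (uea_pi v) = uea_pi (u * v).
Proof.
have reprB w : repr (uea_pi w) - w \in uea_ideal by apply/uea_piP/uea_piK.
rewrite /uea_mul -lock; apply/uea_piP; set u' := repr _; set v' := repr _.
have ->: u' * v' - u * v = (u' - u) * v' + u * (v' - v).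
  by rewrite mulrBl mulrBr addrA subrK.
by apply: rpredD; [apply/ideal_genMr/reprB | apply/ideal_genMl/reprB].
Qed.

Fact uea_mulA : associative uea_mul.
Proof.
move=> u v w; rewrite -[u]uea_piK -[v]uea_piK -[w]uea_piK.
by rewrite !uea_mulE mulrA.
Qed.

Fact uea_mul1r : left_id (uea_pi 1) uea_mul.
Proof. by move=> u; rewrite -[u]uea_piK uea_mulE mul1r. Qed.

Fact uea_mulr1 : right_id (uea_pi 1) uea_mul.
Proof. by move=> u; rewrite -[u]uea_piK uea_mulE mulr1. Qed.

Fact uea_mulDl : left_distributive uea_mul +%R.
Proof.
move=> u v w; rewrite -[u]uea_piK -[v]uea_piK -[w]uea_piK -raddfD.
by rewrite !uea_mulE mulrDl raddfD.
Qed.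

Fact uea_mulDr : right_distributive uea_mul +%R.
Proof.
move=> u v w; rewrite -[u]uea_piK -[v]uea_piK -[w]uea_piK -raddfD.
by rewrite !uea_mulE mulrDr raddfD.
Qed.

(* A Lie algebra morphism from g to A, where A carries the commutator bracket. *)
Definition assoc_rep (A : algType K) (f : g -> A) : Prop :=
  linear f /\ forall x y, f (lie x y) = f x * f y - f y * f x.

Lemma free_lift_ideal (A : algType K) (f : g -> A) (u : F) :
  assoc_rep f -> u \in uea_ideal -> free_lift f u = 0.
Proof.
move=> [f_lin f_lie] /ideal_genP; elim=> [|a x b y Xx _ IH].
  by rewrite raddf0.
rewrite raddfD /= !rmorphM /= IH addr0.
suff -> : free_lift f x = 0 by rewrite mulr0 mul0r.
case: Xx => [c u1 u2|u1 u2].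
  have := free_lift_gen f (c *: u1 + u2); rewrite f_lin.
  have := (free_lift_gen f u1, free_lift_gen f u2).
  move: (free_gen _ _) (free_gen _ _) (free_gen _ _) => z1 z2 z3 [fz1 fz2] fz3.
  by rewrite free_liftB free_liftD free_liftZ fz1 fz2 fz3 subrr.
have := free_lift_gen f (lie u1 u2); rewrite f_lie.
have := (free_lift_gen f u1, free_lift_gen f u2).
move: (free_gen K u1) (free_gen K u2) (free_gen K (lie _ _)) => z1 z2 z3 [fz1 fz2] fz3.
rewrite (free_liftB f (_ - _) z3) (free_liftB f (z1 * z2)).
apply: (etrans (congr2 (fun a b => a - b - free_lift f z3)
  (free_liftM f z1 z2) (free_liftM f z2 z1))).
by rewrite /= fz1 fz2 fz3 subrr.
Qed.

Fact uea_one_neq0 : uea_pi 1 != 0.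
Proof.
have rep0 : assoc_rep (fun _ : g => 0 : K^o).
  by split=> [a x y|x y]; rewrite ?scaler0 ?addr0 ?mulr0 ?subr0.
rewrite -(raddf0 uea_pi); apply/eqP => /uea_piP.
rewrite subr0 => /(free_lift_ideal rep0) /eqP.
by rewrite rmorph1 oner_eq0.
Qed.

HB.instance Definition _ := GRing.Zmodule_isNzRing.Build uea
  uea_mulA uea_mul1r uea_mulr1 uea_mulDl uea_mulDr uea_one_neq0.

Fact uea_scalerAl a (u v : uea) : a *: (u * v) = (a *: u) * v.
Proof.
rewrite -[u]uea_piK -[v]uea_piK -linearZ /=.
by rewrite [X in _ *: X]uea_mulE [RHS]uea_mulE -linearZ /= scalerAl.
Qed.

HB.instance Definition _ := GRing.Lmodule_isLalgebra.Build K uea uea_scalerAl.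

Fact uea_scalerAr a (u v : uea) : a *: (u * v) = u * (a *: v).
Proof.
rewrite -[u]uea_piK -[v]uea_piK -linearZ /=.
by rewrite [X in _ *: X]uea_mulE [RHS]uea_mulE -linearZ /= free_scalerAr.
Qed.

HB.instance Definition _ := GRing.Lalgebra_isAlgebra.Build K uea uea_scalerAr.

Lemma uea_pi_monoid : monoid_morphism uea_pi.
Proof. by split=> // u v; rewrite [RHS]uea_mulE. Qed.

HB.instance Definition _ := GRing.isMonoidMorphism.Build F uea uea_pi uea_pi_monoid.

Definition uea_in (x : g) : uea := uea_pi (free_gen K x).

Lemma uea_in_rep : assoc_rep uea_in.
Proof.
split=> [a x y|x y].
  rewrite /uea_in -linearZ -raddfD; apply/uea_piP.
  exact/mem_ideal_gen/uea_rel_linear.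
rewrite /uea_in -!rmorphM -raddfB; apply/esym/uea_piP.
exact/mem_ideal_gen/uea_rel_lie.
Qed.

Section Lift.
Variables (A : algType K) (f : g -> A) (f_rep : assoc_rep f).

Definition uea_lift of assoc_rep f := fun u : uea => free_lift f (repr u).

Lemma uea_lift_pi u : uea_lift f_rep (uea_pi u) = free_lift f u.
Proof.
apply/eqP; rewrite -subr_eq0 -raddfB /=; apply/eqP.
exact/(free_lift_ideal f_rep)/uea_piP/uea_piK.
Qed.

Lemma uea_lift_linear : linear (uea_lift f_rep).
Proof.
move=> a u v; rewrite -[u]uea_piK -[v]uea_piK.
by rewrite -[in LHS]linearZ -raddfD !uea_lift_pi linearP.
Qed.

Lemma uea_lift_monoid : monoid_morphism (uea_lift f_rep).
Proof.
split=> [|u v]; first by rewrite -[1](rmorph1 uea_pi) uea_lift_pi rmorph1.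
rewrite -[u]uea_piK -[v]uea_piK.
by rewrite -[in LHS](rmorphM uea_pi) !uea_lift_pi rmorphM.
Qed.

HB.instance Definition _ :=
  GRing.isLinear.Build K uea A *:%R (uea_lift f_rep) uea_lift_linear.
HB.instance Definition _ :=
  GRing.isMonoidMorphism.Build uea A (uea_lift f_rep) uea_lift_monoid.

Lemma uea_lift_in x : uea_lift f_rep (uea_in x) = f x.
Proof. by rewrite uea_lift_pi free_lift_gen. Qed.

End Lift.

End UniversalEnveloping.

(* B ⊗_A V, as the quotient of the free left B-module on the symbols 1 ⊗ v by
   1 ⊗ (v + w) = 1 ⊗ v + 1 ⊗ w and 1 ⊗ (a v) = f(a) ⊗ v; tens_univ below is its
   universal property among balanced biadditive maps. *)
Section ExtensionOfScalars.
Variables (A B : nzRingType) (f : {rmorphism A -> B}) (V : lmodType A).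
Local Notation F := {malg B[V]}.

Variant tensor_rel : F -> Prop :=
| tensor_relD (v w : V) : tensor_rel (<< v + w >> - (<< v >> + << w >>))
| tensor_relZ (a : A) (v : V) : tensor_rel (<< a *: v >> - f a *: << v >>).

Definition tensor_submod : submodClosed F := span tensor_rel.

Definition ext_scalars := lmod_quot tensor_submod.

HB.instance Definition _ := GRing.Lmodule.on ext_scalars.

Definition ext_pi (u : F) : ext_scalars := lmod_pi tensor_submod u.

HB.instance Definition _ := GRing.Linear.copy ext_pi (lmod_pi tensor_submod).

Definition tens (b : B) (v : V) : ext_scalars := b *: ext_pi << v >>.

Lemma tens_scale b b' v : b *: tens b' v = tens (b * b') v.
Proof. by rewrite /tens scalerA. Qed.

Lemma tensDl b b' v : tens (b + b') v = tens b v + tens b' v.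
Proof. exact: scalerDl. Qed.

Lemma tensDr b v w : tens b (v + w) = tens b v + tens b w.
Proof.
rewrite /tens -scalerDr -raddfD; congr (_ *: _).
exact/lmod_piP/mem_span/tensor_relD.
Qed.

Lemma tens_balanced b a v : tens (b * f a) v = tens b (a *: v).
Proof.
suff fav : ext_pi << a *: v >> = f a *: ext_pi << v >>.
  by rewrite /tens fav scalerA.
rewrite -(linearZ_LR ext_pi); exact/lmod_piP/mem_span/tensor_relZ.
Qed.

Lemma tens_gen (u : ext_scalars) :
  exists s : seq (B * V), u = \sum_(p <- s) tens p.1 p.2.
Proof.
pose x := repr u; exists [seq (x@_v, v) | v <- msupp x].
rewrite big_map -[LHS](lmod_piK u) [X in lmod_pi _ X](malg_lin_ext x).
by rewrite linear_sum; apply: eq_bigr => v _; rewrite [LHS]linearZ.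
Qed.

Lemma tens_univ (M : zmodType) (h : B -> V -> M) :
    (forall b b' v, h (b + b') v = h b v + h b' v) ->
    (forall b v w, h b (v + w) = h b v + h b w) ->
    (forall b a v, h (b * f a) v = h b (a *: v)) ->
  exists k : {additive ext_scalars -> M}, forall b v, k (tens b v) = h b v.
Proof.
move=> hDl hDr hM.
have h0 v : h 0 v = 0 by apply: (addIr (h 0 v)); rewrite -hDl !add0r.
have hN b v : h (- b) v = - h b v.
  by apply: (addIr (h b v)); rewrite -hDl !addNr h0.
pose H (x : F) : M := \sum_(v <- msupp x) h x@_v v.
have HE (d : {fset V}) x : (msupp x `<=` d)%fset -> H x = \sum_(v <- d) h x@_v v.
  move=> le_xd; rewrite /H (big_fset_incl _ le_xd) // => v _ vNx.
  by rewrite mcoeff_outdom.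
have HB x y : H (x - y) = H x - H y.
  pose d := (msupp (x - y) `|` (msupp x `|` msupp y))%fset.
  rewrite (HE d (x - y)) ?(HE d x) ?(HE d y) ?fsubsetUl //.
  - by rewrite -sumrB; apply: eq_bigr => v _; rewrite mcoeffB hDl hN.
  - by apply/fsubsetP => v vx; rewrite !in_fsetU vx !orbT.
  by apply/fsubsetP => v vx; rewrite !in_fsetU vx !orbT.
have HU b v : H << b *g v >> = h b v.
  by rewrite (HE [fset v]%fset) ?msuppU_le // big_seq_fset1 mcoeffUU.
have HD x y : H (x + y) = H x + H y.
  have H0 : H 0 = 0 by have := HB 0 0; rewrite !subrr.
  have HN : H (- y) = - H y by rewrite -[- y]sub0r HB H0 sub0r.
  by rewrite -{1}[y]opprK HB HN opprK.
have ZU b c v : b *: << c *g v >> = << b * c *g v >> :> F.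
  by apply/malgP => w; rewrite mcoeffZ !mcoeffU mulrnAr.
have HS x : x \in tensor_submod -> H x = 0.
  move=> /spanP; elim=> [|b y z yR _ IHz]; first by have := HB 0 0; rewrite !subrr.
  rewrite HD IHz addr0; case: yR => [v w|a v].
    by rewrite scalerBr scalerDr !ZU HB HD !HU !mulr1 hDr subrr.
  by rewrite scalerBr scalerA !ZU HB !HU !mulr1 hM subrr.
pose k (u : ext_scalars) := H (repr u).
have kE x : k (ext_pi x) = H x.
  by apply/eqP; rewrite -subr_eq0 -HB HS //; apply/lmod_piP/lmod_piK.
have kB : zmod_morphism k.
  move=> u v; rewrite -[u]lmod_piK -[v]lmod_piK.
  by rewrite -(raddfB ext_pi) !kE HB.
pose kM := GRing.isZmodMorphism.Build _ _ k kB.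
pose ka : {additive ext_scalars -> M} := HB.pack k kM.
exists ka => b v; rewrite /= /tens -(linearZ_LR ext_pi) kE.
by rewrite ZU mulr1 HU.
Qed.

End ExtensionOfScalars.

(* Scalar identities behind the Lie algebra axioms, for any bilinear operation
   on a space spanned by vectors dt i k and ct k. *)
Definition vir_cocycle (K : fieldType) (i j : int) : K :=
  if i == - j then (i ^+ 3 - i)%:~R / 12%:R else 0.

Section VirasoroAxioms.
Variables (K : fieldType) (V : lmodType K) (dt : int -> int -> V) (ct : int -> V).
Hypothesis lin_eq0 : forall h : V -> V, linear h ->
  (forall i k, h (dt i k) = 0) -> (forall k, h (ct k) = 0) -> forall x, h x = 0.
Variable br : V -> V -> V.
Hypothesis brDl : forall a x y z, br (a *: x + y) z = a *: br x z + br y z.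
Hypothesis brDr : forall a x y z, br z (a *: x + y) = a *: br z x + br z y.
Hypothesis br_dt : forall i k j l, br (dt i k) (dt j l) =
  (j - i)%:~R *: dt (i + j) (k + l) + vir_cocycle K i j *: ct (k + l).
Hypothesis br_dtct : forall i k l, br (dt i k) (ct l) = 0.
Hypothesis br_ctdt : forall i k l, br (ct l) (dt i k) = 0.
Hypothesis br_ctct : forall k l, br (ct k) (ct l) = 0.

Let br0l x : br 0 x = 0.
Proof. by have := brDl (-1) 0 0 x; rewrite scaler0 addr0 scaleN1r addNr. Qed.

Let br0r x : br x 0 = 0.
Proof. by have := brDr (-1) 0 0 x; rewrite scaler0 addr0 scaleN1r addNr. Qed.

Let cocycle_antisym i j : vir_cocycle K j i = - vir_cocycle K i j.
Proof.
rewrite /vir_cocycle [j == _]eq_sym eqr_oppLR; case: eqP => [->|_]; last by rewrite oppr0.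
by rewrite -mulNr -rmorphN; congr (_%:~R / _); ring.
Qed.

Lemma vir_antisym x y : br y x = - br x y.
Proof.
apply/eqP; rewrite -addr_eq0; apply/eqP.
have br_ctl k : forall v, br (ct k) v + br v (ct k) = 0.
  apply: lin_eq0 => [p u v|i l|l]; rewrite ?br_dtct ?br_ctdt ?br_ctct ?addr0 //.
  by rewrite brDl brDr scalerDr addrACA.
move: x; apply: lin_eq0 => [p u v|i k|k]; last by rewrite addrC br_ctl.
  by rewrite brDl brDr scalerDr addrACA.
move: y; apply: lin_eq0 => [p u v|j l|l]; last by rewrite br_ctl.
  by rewrite brDl brDr scalerDr addrACA.
rewrite !br_dt (cocycle_antisym i j) [i + j]addrC [k + l]addrC scaleNr.
by rewrite addrACA addNr addr0 -scalerDl -rmorphD -opprB addNr scale0r.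
Qed.

Lemma vir_alternating x :
  (forall h : V -> Prop, h 0 -> (forall p i k y, h y -> h (p *: dt i k + y)) ->
    (forall p k y, h y -> h (p *: ct k + y)) -> h x) -> br x x = 0.
Proof.
have step a u y : br u u = 0 -> br y y = 0 -> br (a *: u + y) (a *: u + y) = 0.
  move=> uu yy; rewrite brDl 2!brDr uu yy (vir_antisym u y).
  by rewrite scaler0 add0r addr0 scalerN addrN.
move=> ind; apply: (ind (fun u => br u u = 0)) => [|p i k y IHy|p k y IHy].
- exact: br0l.
- apply: step IHy; rewrite br_dt subrr scale0r add0r /vir_cocycle.
  case: eqP => [ii|_]; last by rewrite scale0r.
  have -> : i = 0 by lia.
  by rewrite expr0n subrr mul0r scale0r.
exact: step (br_ctct _ _) IHy.
Qed.

Let br_ctr x k : br x (ct k) = 0.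
Proof. by move: x; apply: lin_eq0 => // a u v; rewrite brDl. Qed.

Let br_ctl x k : br (ct k) x = 0.
Proof. by rewrite vir_antisym br_ctr oppr0. Qed.

Let br_dt3 i k j l n m :
  br (dt i k) (br (dt j l) (dt n m)) =
  ((n - j)%:~R * (j + n - i)%:~R) *: dt (i + (j + n)) (k + (l + m))
  + ((n - j)%:~R * vir_cocycle K i (j + n)) *: ct (k + (l + m)).
Proof.
rewrite [br (dt j l) _]br_dt brDr -[X in _ + br _ X]addr0 brDr.
by rewrite br_ctr br0r br_dt scaler0 !addr0 scalerDr !scalerA.
Qed.

Let sum3 (a : K) (u1 u2 u3 v1 v2 v3 : V) :
  (a *: u1 + v1) + (a *: u2 + v2) + (a *: u3 + v3)
    = a *: (u1 + u2 + u3) + (v1 + v2 + v3).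
Proof. by rewrite !scalerDr [LHS](AC (2*2*2) ((1*3*5)*(2*4*6))). Qed.

Let sum3_eq0 (p1 p2 p3 q1 q2 q3 : K) (u v : V) :
  p1 + p2 + p3 = 0 -> q1 + q2 + q3 = 0 ->
  (p1 *: u + q1 *: v) + (p2 *: u + q2 *: v) + (p3 *: u + q3 *: v) = 0.
Proof.
move=> p0 q0; rewrite [LHS](AC (2*2*2) ((1*3*5)*(2*4*6))) /=.
by rewrite -!scalerDl p0 q0 !scale0r addr0.
Qed.

Lemma vir_jacobi x y z : br x (br y z) + br y (br z x) + br z (br x y) = 0.
Proof.
move: x; apply: lin_eq0 => [p u v|i k|k]; first by rewrite !(brDl, brDr) sum3.
  2: by rewrite br_ctl br_ctr br_ctl !br0r !addr0.
move: y; apply: lin_eq0 => [p u v|j l|l]; first by rewrite !(brDl, brDr) sum3.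
  2: by rewrite br_ctl br_ctr br_ctl !br0r !addr0.
move: z; apply: lin_eq0 => [p u v|n m|m]; first by rewrite !(brDl, brDr) sum3.
  2: by rewrite br_ctl br_ctr br_ctl !br0r !addr0.
rewrite !br_dt3.
have -> : j + (n + i) = i + (j + n) by ring.
have -> : n + (i + j) = i + (j + n) by ring.
have -> : l + (m + k) = k + (l + m) by ring.
have -> : m + (k + l) = k + (l + m) by ring.
apply: sum3_eq0.
  by rewrite -!intrM -!intrD [X in X%:~R](_ : _ = 0) //; ring.
rewrite /vir_cocycle.
have -> : (j == - (n + i)) = (i == - (j + n)) by apply/eqP/eqP; lia.
have -> : (n == - (i + j)) = (i == - (j + n)) by apply/eqP/eqP; lia.
case: eqP => [->|_]; last by rewrite !mulr0 !addr0.
rewrite !mulrA -!mulrDl -!intrM -!intrD [X in X%:~R](_ : _ = 0) ?mul0r //.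
ring.
Qed.

End VirasoroAxioms.

Section LoopVirasoro.
Variable K : fieldType.

(* (Some i, k) indexes d_i ⊗ t^k and (None, k) indexes c ⊗ t^k. *)
Definition loopvir := {malg K[(option int * int)%type]}.

HB.instance Definition _ := GRing.Lmodule.on loopvir.

Definition dt (i k : int) : loopvir := << (Some i, k) >>.
Definition ct (k : int) : loopvir := << (None, k) >>.

Definition loopvir_basis_lie (a b : option int * int) : loopvir :=
  match a, b with
  | (Some i, k), (Some j, l) =>
      (j - i)%:~R *: dt (i + j) (k + l) + vir_cocycle K i j *: ct (k + l)
  | _, _ => 0
  end.

Definition loopvir_lie (x y : loopvir) : loopvir :=
  locked (lin_ext (fun a => lin_ext (loopvir_basis_lie a) y) x).

Lemma loopvir_lieE x y :
  loopvir_lie x y = lin_ext (fun a => lin_ext (loopvir_basis_lie a) y) x.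
Proof. by rewrite /loopvir_lie -lock. Qed.

Fact loopvir_lieDl a x y z :
  loopvir_lie (a *: x + y) z = a *: loopvir_lie x z + loopvir_lie y z.
Proof. by rewrite !loopvir_lieE linearP. Qed.

Fact loopvir_lieDr a x y z :
  loopvir_lie z (a *: x + y) = a *: loopvir_lie z x + loopvir_lie z y.
Proof.
rewrite !loopvir_lieE !(lin_extw _ (fsubset_refl (msupp z))) scaler_sumr.
rewrite -big_split; apply: eq_bigr => b _.
by rewrite /= linearP scalerDr !scalerA mulrC.
Qed.

Lemma loopvir_lieU a b : loopvir_lie << a >> << b >> = loopvir_basis_lie a b.
Proof. by rewrite loopvir_lieE !lin_extU. Qed.

Lemma loopvir_ind (h : loopvir -> Prop) :
    h 0 -> (forall p i k y, h y -> h (p *: dt i k + y)) ->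
    (forall p k y, h y -> h (p *: ct k + y)) -> forall x, h x.
Proof.
move=> h0 hd hc x; rewrite (malg_lin_ext x).
elim: (X in \sum_(b <- X) _) => [|[[i|] k] s IHs]; rewrite ?big_nil // big_cons.
  exact: hd.
exact: hc.
Qed.

Lemma loopvir_lin_eq0 (h : loopvir -> loopvir) :
    linear h -> (forall i k, h (dt i k) = 0) -> (forall k, h (ct k) = 0) ->
  forall x, h x = 0.
Proof.
move=> h_lin hd hc.
have h0 : h 0 = 0 by have := h_lin (-1) 0 0; rewrite scaler0 addr0 scaleN1r addNr.
by apply: loopvir_ind => // [p i k y IHy|p k y IHy]; rewrite h_lin IHy ?hd ?hc scaler0 addr0.
Qed.

Lemma loopvir_lie_dt i k j l : loopvir_lie (dt i k) (dt j l) =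
  (j - i)%:~R *: dt (i + j) (k + l) + vir_cocycle K i j *: ct (k + l).
Proof. exact: loopvir_lieU. Qed.

Fact loopvir_liexx x : loopvir_lie x x = 0.
Proof.
apply: (@vir_alternating K loopvir dt ct loopvir_lin_eq0 loopvir_lie
  loopvir_lieDl loopvir_lieDr loopvir_lie_dt); try by move=> *; exact: loopvir_lieU.
by move=> h h0 hd hc; apply: loopvir_ind.
Qed.

Fact loopvir_jacobi x y z :
  loopvir_lie x (loopvir_lie y z) + loopvir_lie y (loopvir_lie z x)
    + loopvir_lie z (loopvir_lie x y) = 0.
Proof.
by apply: (@vir_jacobi K loopvir dt ct loopvir_lin_eq0 loopvir_lie
  loopvir_lieDl loopvir_lieDr loopvir_lie_dt) => *; exact: loopvir_lieU.
Qed.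

HB.instance Definition _ := Lmodule_isLieAlgebra.Build K loopvir
  loopvir_lieDl loopvir_lieDr loopvir_liexx loopvir_jacobi.

Lemma lie_dtdt i k j l : lie (dt i k) (dt j l) =
  (j - i)%:~R *: dt (i + j) (k + l) + vir_cocycle K i j *: ct (k + l).
Proof. exact: loopvir_lie_dt. Qed.

Lemma lie_dtct i k l : lie (dt i k) (ct l) = 0.
Proof. exact: loopvir_lieU. Qed.

Lemma lie_ctdt i k l : lie (ct k) (dt i l) = 0.
Proof. exact: loopvir_lieU. Qed.

Lemma lie_ctct k l : lie (ct k) (ct l) = 0.
Proof. exact: loopvir_lieU. Qed.

End LoopVirasoro.

Lemma span_lie_closed (K : fieldType) (g : lieType K) (X : g -> Prop) :
    (forall x y, X x -> X y -> lie x y \in span X) ->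
  forall x y, x \in span X -> y \in span X -> lie x y \in span X.
Proof.
move=> XX x y /spanP xS /spanP yS; elim: xS => [|a u v uG _ IHx].
  by rewrite lie0x rpred0.
rewrite lieDl rpredD ?rpredZ // {v IHx}.
elim: yS => [|b w v wG _ IHy]; first by rewrite liex0 rpred0.
by rewrite lieDr rpredD ?rpredZ //; exact: XX.
Qed.

Section LoopVirasoroGe.
Variables (K : fieldType) (N : nat).

Variant loopvir_ge_gen : loopvir K -> Prop :=
| loopvir_ge_dt (i k : int) : N%:Z <= i -> loopvir_ge_gen (dt K i k)
| loopvir_ge_ct (k : int) : loopvir_ge_gen (ct K k).

Record loopvir_ge := LoopvirGe {
  loopvir_ge_val : loopvir K;
  loopvir_ge_mem : loopvir_ge_val \in span loopvir_ge_gen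
}.

HB.instance Definition _ := [isSub for loopvir_ge_val].
HB.instance Definition _ := [Choice of loopvir_ge by <:].
HB.instance Definition _ := [SubChoice_isSubLmodule of loopvir_ge by <:].

Lemma loopvir_ge_lie_closed (x y : loopvir K) :
  x \in span loopvir_ge_gen -> y \in span loopvir_ge_gen ->
  lie x y \in span loopvir_ge_gen.
Proof.
apply: span_lie_closed => {}x {}y [i k Ni|k] [j l Nj|l].
- suff dct p q m n s : N%:Z <= m ->
      p *: dt K m n + q *: ct K s \in span loopvir_ge_gen.
    by rewrite lie_dtdt; apply: dct; lia.
  move=> Nm.
  have dS : dt K m n \in span loopvir_ge_gen by exact/mem_span/loopvir_ge_dt.
  have cS : ct K s \in span loopvir_ge_gen by exact/mem_span/loopvir_ge_ct.
  by rewrite rpredD // rpredZ.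
- by rewrite lie_dtct rpred0.
- by rewrite lie_ctdt rpred0.
by rewrite lie_ctct rpred0.
Qed.

Definition loopvir_ge_lie (x y : loopvir_ge) : loopvir_ge :=
  LoopvirGe (loopvir_ge_lie_closed (loopvir_ge_mem x) (loopvir_ge_mem y)).

Let valL a x y :
  loopvir_ge_val (a *: x + y) = a *: loopvir_ge_val x + loopvir_ge_val y.
Proof. exact: (linearP (\val : loopvir_ge -> loopvir K)). Qed.

Let val0 : loopvir_ge_val 0 = 0.
Proof. exact: (raddf0 (\val : loopvir_ge -> loopvir K)). Qed.

Let valD x y : loopvir_ge_val (x + y) = loopvir_ge_val x + loopvir_ge_val y.
Proof. exact: (raddfD (\val : loopvir_ge -> loopvir K)). Qed.

Fact loopvir_ge_lieDl a x y z :
  loopvir_ge_lie (a *: x + y) z = a *: loopvir_ge_lie x z + loopvir_ge_lie y z.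
Proof. by apply: val_inj; rewrite /= lieDl. Qed.

Fact loopvir_ge_lieDr a x y z :
  loopvir_ge_lie z (a *: x + y) = a *: loopvir_ge_lie z x + loopvir_ge_lie z y.
Proof. by apply: val_inj; rewrite /= lieDr. Qed.

Fact loopvir_ge_liexx x : loopvir_ge_lie x x = 0.
Proof. by apply: val_inj; rewrite /= liexx. Qed.

Fact loopvir_ge_jacobi x y z :
  loopvir_ge_lie x (loopvir_ge_lie y z) + loopvir_ge_lie y (loopvir_ge_lie z x)
    + loopvir_ge_lie z (loopvir_ge_lie x y) = 0.
Proof. by apply: val_inj; rewrite /= lie_jacobi. Qed.

HB.instance Definition _ := Lmodule_isLieAlgebra.Build K loopvir_ge
  loopvir_ge_lieDl loopvir_ge_lieDr loopvir_ge_liexx loopvir_ge_jacobi.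

Definition loopvir_ge_incl (x : loopvir_ge) : loopvir K := \val x.

HB.instance Definition _ :=
  GRing.isLinear.Build K loopvir_ge (loopvir K) *:%R loopvir_ge_incl valL.

Fact loopvir_ge_incl_lie x y :
  loopvir_ge_incl (lie x y) = lie (loopvir_ge_incl x) (loopvir_ge_incl y).
Proof. by []. Qed.

HB.instance Definition _ :=
  isLieMorphism.Build K loopvir_ge (loopvir K) loopvir_ge_incl loopvir_ge_incl_lie.

Definition dt_ge (i k : int) (N_le_i : N%:Z <= i) : loopvir_ge :=
  LoopvirGe (mem_span (loopvir_ge_dt k N_le_i)).

End LoopVirasoroGe.

Section WhittakerModule.
Variables (K : fieldType) (N : nat) (phi : {lie loopvir_ge K N -> K^o}).
Local Notation L := (loopvir K).
Local Notation LN := (loopvir_ge K N).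

Fact incl_rep : assoc_rep (fun x : LN => uea_in (loopvir_ge_incl x)).
Proof.
have [in_lin in_lie] := @uea_in_rep K L.
by split=> [a x y|x y]; rewrite ?linearP ?lie_morph ?in_lin ?in_lie.
Qed.

Definition uea_incl : uea LN -> uea L := uea_lift incl_rep.

HB.instance Definition _ := GRing.RMorphism.copy uea_incl (uea_lift incl_rep).

Fact whittaker_rep : assoc_rep phi.
Proof.
split=> [a x y|x y]; first by rewrite linearP.
by rewrite lie_morph mulrC subrr.
Qed.

Definition whittaker_line : Type := K^o.

HB.instance Definition _ := GRing.Zmodule.copy whittaker_line K^o.

Definition whittaker_scale (u : uea LN) (z : whittaker_line) : whittaker_line :=
  uea_lift whittaker_rep u * (z : K^o).

Fact whittaker_scalerA u v z :
  whittaker_scale u (whittaker_scale v z) = whittaker_scale (u * v) z.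
Proof. by rewrite /whittaker_scale rmorphM mulrA. Qed.

Fact whittaker_scale1r : left_id 1 whittaker_scale.
Proof. by move=> z; rewrite /whittaker_scale rmorph1 mul1r. Qed.

Fact whittaker_scalerDr : right_distributive whittaker_scale +%R.
Proof. by move=> u y z; rewrite /whittaker_scale mulrDr. Qed.

Fact whittaker_scalerDl z : {morph whittaker_scale^~ z : u v / u + v}.
Proof. by move=> u v; rewrite /whittaker_scale raddfD mulrDl. Qed.

HB.instance Definition _ := GRing.Zmodule_isLmodule.Build (uea LN) whittaker_line
  whittaker_scalerA whittaker_scale1r whittaker_scalerDr whittaker_scalerDl.

Lemma whittaker_lineE (x : LN) (z : whittaker_line) :
  uea_in x *: z = phi x * z :> K.
Proof. by rewrite -(uea_lift_in whittaker_rep). Qed.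

Definition whittaker_module := ext_scalars uea_incl whittaker_line.

HB.instance Definition _ := GRing.Lmodule.on whittaker_module.

End WhittakerModule.

(* K[t, t^-1]; only its vector space structure and the basis of the powers t^r
   matter for functionals. *)
Definition laurent (K : fieldType) := {malg K[int]}.

HB.instance Definition _ (K : fieldType) := GRing.Lmodule.on (laurent K).

Definition tpow (K : fieldType) (r : int) : laurent K := << r >>.

Definition whittaker_coef (K : fieldType) (N : nat)
    (phi : {lie loopvir_ge K N -> K^o}) (n : int) (N_le_n : N%:Z <= n)
    : {linear laurent K -> K^o} :=
  lin_ext (fun r : int => phi (dt_ge K r N_le_n)).

Lemma whittaker_coefE K N (phi : {lie loopvir_ge K N -> K^o}) n (N_le_n : N%:Z <= n) r :
  whittaker_coef phi N_le_n (tpow K r) = phi (dt_ge K r N_le_n).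
Proof. exact: lin_extU. Qed.

Definition exp_polynomial (K : fieldType) (chi : {linear laurent K -> K^o}) : Prop :=
  exists (c : nat -> K -> K) (m : nat) (s : seq K),
    [/\ uniq s, 0 \notin s & forall n : int,
      chi (tpow K n) = \sum_(k < m) \sum_(l <- s) c k l * n%:~R ^+ k * l ^ n].

Lemma leN_double (N : nat) : N%:Z <= (2 * N)%N%:Z.
Proof. lia. Qed.

Lemma leN_double_pred (N : nat) : (0 < N)%N -> N%:Z <= (2 * N)%N%:Z - 1.
Proof. lia. Qed.

(* Main.v *)
From HB Require Import structures.
Require Import Defs.
From mathcomp Require Import all_boot all_order all_algebra finmap.
From mathcomp Require Import complex boolp reals monalg.
From mathcomp Require Import ring zify.

Set Implicit Arguments.
Unset Strict Implicit.
Unset Printing Implicit Defensive.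

Import Order.TTheory GRing.Theory Num.Theory.
Local Open Scope ring_scope.

(** The theorem compares the universal module [W] generated by [v] with the
    sequences [f n : k |-> phi (d_n t^k)].  Over an algebraically closed field
    of characteristic 0 a sequence on the integers is exponential-polynomial
    exactly when some nonzero polynomial in the shift kills it
    ([recurrent_exppoly]).  Moreover [f n = 0] for [n > 2N], because there
    [d_n t^k] is a bracket of two elements of the subalgebra.  The claim is
    therefore that [W] is simple unless both [f (2N)] and [f (2N-1)] satisfy
    a linear recurrence.

    Existence of enough functionals on [W] rests on the
    Poincare-Birkhoff-Witt theorem.  Words in an ordered basis of a Lie algebra
    [g] are straightened into nondecreasing words, and the Jacobi identity
    makes the result independent of the order of the steps
    ([straightens_all]).  If the basis elements in an upper set span a
    subalgebra [h] with a character [chi], then straightening followed by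
    [chi] gives a functional [k] on [U(g)] with [k 1 = 1] and
    [k (u x) = chi x * k u] for [x] in [h] ([character_functional]).  It
    descends to the induced module; in particular [v <> 0].

    Suppose that one monic polynomial [p] kills both sequences.  Put
    [P = d_(N-1) p(t)].  Every bracket of [P] with the subalgebra stays in the
    subalgebra and only involves [f n] for [n >= 2N-1], so [phi] vanishes on
    it.  Hence [phi] extends to the subalgebra enlarged by [P], with any value
    [alpha] at [P], and the functional so obtained ([adjoin_whit]) shows that
    [(P - alpha) v] generates a submodule that does not contain [v].  Were [W]
    simple, [P v = alpha v] would hold for all [alpha]; the values 0 and 1
    already contradict each other.

    Suppose that one of the sequences is not recurrent.  Let [s = 2N] if
    [f (2N)] is not recurrent; otherwise let [s = 2N-1] and let [p] kill
    [f (2N)].  Give the letter [d_i t^k] with [i < N] the weight [s - i > 0].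
    Modulo words of lower weight the letters commute, so the part of top weight
    of a combination of words is a commutative polynomial, its symbol.  On the
    Laurent polynomials [q] with [f n (q t^k) = 0] for all [n > s] and all [k],
    the functionals [q |-> f s (q t^k)] remain linearly independent
    ([multiplier_dual]).  In the top symbol of a nonzero element of a submodule
    pick a letter [x0 = d_i0 t^k0] with [i0] minimal.  For [q] dual to [k0], the operator
    [d_(s-i0) q - phi (d_(s-i0) q)] acts on this symbol as the nonzero multiple
    [2 i0 - s] of the partial derivative in [x0], up to lower weight
    ([Fil_convD_min]).  It keeps the submodule stable and strictly lowers the
    weight of a nonzero symbol, so iterating it reaches a nonzero multiple of
    [v] ([left_ideal_full]).  Here words only need to span, because the
    argument carries a nonzero symbol along. *)

(** * Linear functionals on free modules *)

Lemma eq_lin_ext (K : nzRingType) (B : choiceType) (V : lmodType K)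
  (f1 f2 : B -> V) (x : {malg K[B]}) :
  (forall b, b \in msupp x -> f1 b = f2 b) -> lin_ext f1 x = lin_ext f2 x.
Proof. by move=> eqf; apply: eq_big_seq => b bx; rewrite eqf. Qed.

Lemma malg_ind (K : nzRingType) (B : choiceType) (P : {malg K[B]} -> Prop) :
  P 0 -> (forall c b x, P x -> P (c *: << b >> + x)) -> forall x, P x.
Proof.
move=> P0 PD x; rewrite (malg_lin_ext x).
by elim: (X in \sum_(b <- X) _) => [|b s IHs]; rewrite ?big_nil // big_cons; apply: PD.
Qed.

Lemma mcoeff_lin_ext (K : nzRingType) (B C : choiceType) (F : B -> {malg K[C]}) x c :
  (lin_ext F x)@_c = \sum_(b <- msupp x) x@_b * (F b)@_c.
Proof.
have E (t : seq B) : (\sum_(b <- t) x@_b *: F b)@_c = \sum_(b <- t) x@_b * (F b)@_c.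
  by elim: t => [|b t IH]; rewrite ?big_nil ?mcoeff0 // !big_cons mcoeffD mcoeffZ IH.
exact: E.
Qed.

Lemma lin_ext_comp (K : nzRingType) (B C : choiceType) (V : lmodType K)
    (F : B -> {malg K[C]}) (G : C -> V) x :
  lin_ext G (lin_ext F x) = lin_ext (fun b => lin_ext G (F b)) x.
Proof. by rewrite [lin_ext F x]/(lin_ext _ _) linear_sum; apply: eq_bigr => b _; rewrite linearZ_LR. Qed.

Lemma scalar0 (K : nzRingType) (V : lmodType K) (h : V -> K) :
  (forall c x y, h (c *: x + y) = c * h x + h y) -> h 0 = 0.
Proof. by move=> h_lin; have := h_lin (-1) 0 0; rewrite scaler0 addr0 mulN1r addNr. Qed.

Section Functional.
Variables (K : fieldType) (B : choiceType).
Implicit Types (F : B -> K) (p q : {malg K[B]}).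

Definition lin_form F p : K := lin_ext (F : B -> K^o) p.

Lemma lin_formP F c p q : lin_form F (c *: p + q) = c * lin_form F p + lin_form F q.
Proof. exact: (linearP (lin_ext (F : B -> K^o))). Qed.

Lemma lin_form0 F : lin_form F 0 = 0.
Proof. exact: (raddf0 (lin_ext (F : B -> K^o))). Qed.

Lemma lin_formD F p q : lin_form F (p + q) = lin_form F p + lin_form F q.
Proof. exact: (raddfD (lin_ext (F : B -> K^o))). Qed.

Lemma lin_formN F p : lin_form F (- p) = - lin_form F p.
Proof. exact: (raddfN (lin_ext (F : B -> K^o))). Qed.

Lemma lin_formU F b : lin_form F << b >> = F b.
Proof. exact: (@lin_extU K B K^o). Qed.

Lemma eq_lin_form F1 F2 p : (forall b, b \in msupp p -> F1 b = F2 b) -> lin_form F1 p = lin_form F2 p.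
Proof. exact: (@eq_lin_ext K B K^o). Qed.

End Functional.

Section FunctionalCalculus.
Variable K : fieldType.

Lemma lin_form_lin (B : choiceType) (F1 F2 : B -> K) c (p : {malg K[B]}) :
  lin_form (fun z => c * F1 z + F2 z) p = c * lin_form F1 p + lin_form F2 p.
Proof.
elim/malg_ind: p => [|k z p IHp]; first by rewrite !lin_form0 mulr0 addr0.
by rewrite !lin_formP IHp !lin_formU; ring.
Qed.

Lemma lin_form_sub (B : choiceType) (F1 F2 : B -> K) (p : {malg K[B]}) :
  lin_form (fun z => F1 z - F2 z) p = lin_form F1 p - lin_form F2 p.
Proof.
elim/malg_ind: p => [|k z p IHp]; first by rewrite !lin_form0 subr0.
by rewrite !lin_formP IHp !lin_formU; ring.
Qed.

Lemma lin_form_const0 (B : choiceType) (p : {malg K[B]}) : lin_form (fun=> 0) p = 0.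
Proof.
elim/malg_ind: p => [|k z p IHp]; first by rewrite !lin_form0.
by rewrite !lin_formP IHp !lin_formU mulr0 addr0.
Qed.

Lemma lin_form_scale (B : choiceType) (F : B -> K) c (p : {malg K[B]}) :
  lin_form (fun z => c * F z) p = c * lin_form F p.
Proof.
elim/malg_ind: p => [|k z p IHp]; first by rewrite !lin_form0 mulr0.
by rewrite !lin_formP IHp !lin_formU; ring.
Qed.

Lemma lin_formC (B1 B2 : choiceType) (F : B1 -> B2 -> K) (p : {malg K[B1]}) (q : {malg K[B2]}) :
  lin_form (fun z => lin_form (F z) q) p = lin_form (fun u => lin_form (F^~ u) p) q.
Proof.
elim/malg_ind: p => [|k z p IHp].
  rewrite lin_form0 -[LHS](lin_form_const0 q); apply: eq_lin_form => u _; by rewrite lin_form0.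
rewrite lin_formP IHp lin_formU -lin_form_lin; apply: eq_lin_form => u _; by rewrite lin_formP lin_formU.
Qed.

End FunctionalCalculus.

(** * Normal forms of words in an ordered basis *)

Lemma lieC (K : fieldType) (g : lieType K) (x y : g) : lie y x = - lie x y.
Proof.
have := liexx (1 *: x + y); rewrite lieDl !lieDr !scale1r !liexx add0r addr0.
by move/eqP; rewrite addrC addr_eq0 => /eqP.
Qed.

Lemma lierN (K : fieldType) (g : lieType K) (x y : g) : lie x (- y) = - lie x y.
Proof. by have := lieDr (-1) y 0 x; rewrite liex0 !addr0 !scaleN1r. Qed.

Lemma cat_prefix (T : Type) (a1 r1 a r : seq T) :
  a1 ++ r1 = a ++ r -> (size a1 <= size a)%N ->
  exists2 c, a = a1 ++ c & r1 = c ++ r.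
Proof.
elim: a1 a => [|z a1 IH] [|y a] //=; first by exists [::].
  by exists (y :: a).
by case=> -> /IH IHa /IHa [c -> ->]; exists c.
Qed.

(** [e] is a basis of [g] indexed by [B], with coordinate map [cf]; the order
    of the basis is pulled back along [rk].  The function [eps] prescribes the
    values of the functional under construction on nondecreasing words. *)
Section NormalForm.
Variables (K : fieldType) (g : lieType K) (d : Order.disp_t) (T : orderType d).
Variables (B : choiceType) (rk : B -> T) (e : B -> g) (cf : {linear g -> {malg K[B]}}).
Hypothesis rk_inj : injective rk.
Hypothesis cfK : forall x, lin_ext e (cf x) = x.
Variable eps : seq B -> K.
Implicit Types (a b w : seq B) (x y z : B) (p : {malg K[B]}).

Definition basis_lie x y : {malg K[B]} := cf (lie (e x) (e y)).

Fixpoint descent w : option (seq B * B * B * seq B) :=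
  match w with
  | y :: w1 => match w1 with
    | x :: b => if (rk x < rk y)%O then Some ([::], y, x, b)
                else omap (fun q => (y :: q.1.1.1, q.1.1.2, q.1.2, q.2)) (descent w1)
    | [::] => None
    end
  | [::] => None
  end.

Definition sorted_word w := sorted (fun x y => rk x <= rk y)%O w.

Variant descent_spec w : option (seq B * B * B * seq B) -> Prop :=
| DescentSome a y x b of w = a ++ y :: x :: b & (rk x < rk y)%O
    & (forall a' y' x' b', w = a' ++ y' :: x' :: b' -> (rk x' < rk y')%O ->
       (size a <= size a')%N) : descent_spec w (Some (a, y, x, b))
| DescentNone of sorted_word w : descent_spec w None.

Lemma descent_cons y x b : descent (y :: x :: b) =
  if (rk x < rk y)%O then Some ([::], y, x, b)
  else omap (fun q => (y :: q.1.1.1, q.1.1.2, q.1.2, q.2)) (descent (x :: b)).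
Proof. by []. Qed.

Lemma descentP w : descent_spec w (descent w).
Proof.
elim: w => [|y [|x b] IH]; try by constructor.
rewrite descent_cons; case: ltP => [lt_xy|le_yx].
  by constructor => // -[|y0 a'].
case: IH => [a y1 x1 b1 eq1 lt1 min1|sorted_xb] /=; last first.
  by constructor; rewrite /sorted_word /= le_yx.
apply: DescentSome; rewrite ?eq1 // -eq1 => -[|y0 a'] y' x' b' /=.
  by move=> [<- <- _]; rewrite ltNge le_yx.
by move=> [_] eq2 lt2; rewrite ltnS; apply: min1 eq2 lt2.
Qed.

Fixpoint inversions w : nat :=
  if w is x :: s then (count (fun y => rk y < rk x)%O s + inversions s)%N else 0%N.

Lemma inversions_swap a x y b : (rk x < rk y)%O ->
  inversions (a ++ y :: x :: b) = (inversions (a ++ x :: y :: b)).+1.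
Proof.
move=> lt_xy; elim: a => [|z a IH] /=.
  by rewrite lt_xy ltNge ltW //=; lia.
rewrite IH addnS; congr (_ + _).+1.
by rewrite !count_cat /=; lia.
Qed.

Lemma inversions_le w : (inversions w <= size w * size w)%N.
Proof.
elim: w => //= x s IH; have := count_size (fun y => rk y < rk x)%O s; nia.
Qed.

(** Straightening a descent either removes an inversion at constant length or
    shortens the word; one natural number decreases in both cases.  A word has
    at most quadratically many inversions, hence the cube of the length. *)
Definition straight_measure w := (size w ^ 3 + inversions w)%N.

Lemma straight_measure_size w w' :
  (size w' < size w)%N -> (straight_measure w' < straight_measure w)%N.
Proof.
rewrite /straight_measure; have := inversions_le w'.
move: (inversions w') (inversions w) (size w') (size w) => i' i l' l.
rewrite !expnS expn0 !muln1 => le_i lt_l.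
suff: (l' * (l' * l') + l' * l' < l * (l * l))%N by lia.
have ll : (l'.+1 * (l'.+1 * l'.+1) <= l * (l * l))%N by rewrite !leq_mul.
nia.
Qed.

Lemma straight_measure_swap a x y b : (rk x < rk y)%O ->
  (straight_measure (a ++ x :: y :: b) < straight_measure (a ++ y :: x :: b))%N.
Proof.
by move=> lt_xy; rewrite /straight_measure (inversions_swap a b lt_xy) !size_cat addnS ltnSn.
Qed.

(** Straightening replaces a descent [y x] by [x y + [y, x]].  The natural
    number is fuel, and [straight_measure] always suffices. *)
Fixpoint nform_rec (n : nat) w : K :=
  if n is n'.+1 then
    if descent w is Some (a, y, x, b) then
      nform_rec n' (a ++ x :: y :: b)
      + lin_form (fun z => nform_rec n' (a ++ z :: b)) (basis_lie y x)
    else eps w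
  else 0.

Definition nform w := nform_rec (straight_measure w).+1 w.

Definition nform_at a p b : K := lin_form (fun z => nform (a ++ z :: b)) p.

Lemma nform_rec_fuel n w : (straight_measure w < n)%N -> nform_rec n w = nform w.
Proof.
rewrite /nform; move: {2 4}(_.+1) (ltnSn (straight_measure w)) => m.
elim: n m w => // n IH [//|m] w /= ltm ltn.
case: descentP ltm ltn => // a y x b -> lt_xy _ ltm ltn.
have lt_swap := straight_measure_swap a b lt_xy.
congr (_ + _); first by apply: IH; lia.
apply: eq_lin_form => z _; have lt_z : (straight_measure (a ++ z :: b)
    < straight_measure (a ++ y :: x :: b))%N.
  by apply: straight_measure_size; rewrite !size_cat /= !addnS.
by apply: IH; lia.
Qed.

Lemma sorted_word_descent a y x b :
  sorted_word (a ++ y :: x :: b) -> (rk y <= rk x)%O.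
Proof.
rewrite /sorted_word; case: a => /= [/andP[]//|z a].
by rewrite cat_path /= => /and4P[].
Qed.

Lemma nform_sorted w : sorted_word w -> nform w = eps w.
Proof.
rewrite /nform /=; case: descentP => // a y x b -> lt_xy _.
by move/sorted_word_descent; rewrite leNgt lt_xy.
Qed.

Lemma nform_descent w a y x b : descent w = Some (a, y, x, b) ->
  nform w = nform (a ++ x :: y :: b) + nform_at a (basis_lie y x) b.
Proof.
rewrite {1}/nform /= => eq_d; rewrite eq_d.
case: descentP eq_d => // a' y' x' b' eq_w lt_xy _ [eqa eqy eqx eqb].
subst a' y' x' b' w.
congr (_ + _).
  by apply: nform_rec_fuel; apply: straight_measure_swap.
apply: eq_lin_form => z _; apply: nform_rec_fuel; apply: straight_measure_size.
by rewrite !size_cat /= !addnS.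
Qed.

Lemma nform_atP a c p q b : nform_at a (c *: p + q) b = c * nform_at a p b + nform_at a q b.
Proof. exact: lin_formP. Qed.

Lemma nform_atU a z b : nform_at a << z >> b = nform (a ++ z :: b).
Proof. exact: lin_formU. Qed.

Lemma nform_atN a p b : nform_at a (- p) b = - nform_at a p b.
Proof. exact: lin_formN. Qed.

Lemma nform_at0 a b : nform_at a 0 b = 0.
Proof. exact: lin_form0. Qed.

Lemma nform_atD a p q b : nform_at a (p + q) b = nform_at a p b + nform_at a q b.
Proof. exact: lin_formD. Qed.

Lemma basis_lieC x y : basis_lie y x = - basis_lie x y.
Proof. by rewrite /basis_lie lieC raddfN. Qed.

Lemma basis_liexx x : basis_lie x x = 0.
Proof. by rewrite /basis_lie liexx raddf0. Qed.

(** [nform] is defined through the leftmost descent only; [straightens w] says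
    that every descent of [w] gives the same value. *)
Definition straightens w := forall a y x b, w = a ++ y :: x :: b ->
  (rk x < rk y)%O -> nform w = nform (a ++ x :: y :: b) + nform_at a (basis_lie y x) b.

(** Once every descent may be straightened, any two adjacent letters commute up
    to their bracket: if they are not in order, swap their roles, and equal
    letters have zero bracket. *)
Lemma straightens_comm a x y b :
    (forall w, size w = size (a ++ x :: y :: b) -> straightens w) ->
  nform (a ++ x :: y :: b) - nform (a ++ y :: x :: b) = nform_at a (basis_lie x y) b.
Proof.
move=> str; case: (ltgtP (rk x) (rk y)) => [lt_xy|lt_yx|/rk_inj ->].
- rewrite (str (a ++ y :: x :: b) _ a y x b) // ?size_cat //.
  by rewrite opprD addrA subrr sub0r basis_lieC nform_atN opprK.
- by rewrite (str _ erefl a x y b) // addrC addKr.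
by rewrite subrr basis_liexx nform_at0.
Qed.

Lemma straightens_lie a p y b :
    (forall w, size w = (size a + size b).+2 -> straightens w) ->
  nform_at a p (y :: b) - nform_at (rcons a y) p b
    = nform_at a (cf (lie (lin_ext e p) (e y))) b.
Proof.
move=> str; elim/malg_ind: p => [|c x p IHp].
  by rewrite !raddf0 lie0x raddf0 !nform_at0 subr0.
rewrite [lin_ext _ _]linearP /= lin_extU lieDl linearP /= !nform_atP -IHp !nform_atU.
rewrite cat_rcons -straightens_comm; first by ring.
by move=> w; rewrite size_cat /= !addnS; apply: str.
Qed.

Definition nform_at2 a p c q b : K := lin_form (fun z => nform_at (a ++ z :: c) q b) p.

(** Straightening two disjoint descents by brackets can be done in either
    order. *)
Lemma nform_at2C a p c q b :
  nform_at2 a p c q b = lin_form (fun u => nform_at a p (c ++ u :: b)) q.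
Proof.
elim/malg_ind: p => [|k z p IHp].
  rewrite [LHS]lin_form0; elim/malg_ind: q => [|k u q IHq]; first by rewrite lin_form0.
  by rewrite lin_formP -IHq lin_formU nform_at0 mulr0 addr0.
rewrite /nform_at2 lin_formP -/(nform_at2 a p c q b) {}IHp lin_formU.
elim/malg_ind: q => [|h u q IHq]; first by rewrite !lin_form0 nform_at0 mulr0 addr0.
rewrite !lin_formP -IHq !lin_formU nform_atP !nform_atU nform_atP nform_atU -catA /=; ring.
Qed.

(** Confluence.  A descent at a position other than the leftmost one is either
    disjoint from the leftmost descent, and then both orders of straightening
    agree by induction, or it overlaps the leftmost one in [y1 > x1 > x], and
    then the difference of both orders is an instance of the Jacobi
    identity. *)
Lemma straightens_all w : straightens w.
Proof.
have [n] := ubnP (straight_measure w); elim: n w => // n IH w lt_w a y x b eq_w lt_xy.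
have {}IH w' : (straight_measure w' < straight_measure w)%N -> straightens w'.
  by move=> lt_w'; apply: IH; lia.
have IHsize w' : (size w' < size w)%N -> straightens w'.
  by move=> lt_w'; apply/IH/straight_measure_size.
case eq_d: (descent w) => [[[[a1 y1] x1] b1]|]; last first.
  case: descentP eq_d => //; rewrite eq_w => /sorted_word_descent.
  by rewrite leNgt lt_xy.
have := nform_descent eq_d.
case: descentP eq_d => // a1' y1' x1' b1' eq_w1 lt1 min1 [? ? ? ?] eq_n; subst a1' y1' x1' b1'.
have le_a := min1 _ _ _ _ eq_w lt_xy.
have [c eq_a eq_b1] := cat_prefix (etrans (esym eq_w1) eq_w) le_a.
have swap_lt a0 x0 y0 b0 : (rk x0 < rk y0)%O ->
    (straight_measure (a0 ++ y0 :: x0 :: b0) <= straight_measure w)%N ->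
    (straight_measure (a0 ++ x0 :: y0 :: b0) < straight_measure w)%N.
  by move=> lt0; apply: leq_trans; apply: straight_measure_swap.
case: c eq_a eq_b1 => [|y1' [|x1' c]] eq_a /=.
- by move=> [? ? ?]; subst x1 y1 b1 a; rewrite cats0 eq_n.
- move=> [? ? ?]; subst y1' y b1 a; rewrite eq_n.
  (* Overlapping descents: both ways of reversing [y1 x1 x] are expanded down
     to the word [x x1 y1] plus words with one letter less. *)
  have lt_xy1 := lt_trans lt_xy lt1.
  have lt_w1 : (straight_measure (a1 ++ [:: x1, y1, x & b]) < straight_measure w)%N.
    by apply: swap_lt; rewrite // eq_w1.
  have lt_w2 : (straight_measure (a1 ++ [:: x1, x, y1 & b]) < straight_measure w)%N.
    by rewrite -cat_rcons; apply: swap_lt; rewrite // cat_rcons ltnW.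
  have lt_w3 : (straight_measure (a1 ++ [:: y1, x, x1 & b]) < straight_measure w)%N.
    by rewrite -cat_rcons; apply: swap_lt; rewrite // cat_rcons eq_w1.
  have lt_w4 : (straight_measure (a1 ++ [:: x, y1, x1 & b]) < straight_measure w)%N.
    by apply: swap_lt; rewrite // ltnW.
  have := IH _ lt_w1 (rcons a1 x1) y1 x b; rewrite !cat_rcons => -> //.
  rewrite (IH _ lt_w2 a1 x1 x (y1 :: b)) // -!catA /= (IH _ lt_w3 a1 y1 x (x1 :: b)) //.
  have := IH _ lt_w4 (rcons a1 x) y1 x1 b; rewrite !cat_rcons => -> //.
  have lieE p y : nform_at a1 p (y :: b)
      = nform_at (rcons a1 y) p b + nform_at a1 (cf (lie (lin_ext e p) (e y))) b.
    rewrite -straightens_lie; first by rewrite addrC subrK.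
    by move=> w' sz_w'; apply: IHsize; rewrite sz_w' eq_w1 size_cat /= !addnS.
  rewrite !lieE !cfK cats1.
  have jac : nform_at a1 (cf (lie (lie (e y1) (e x1)) (e x))) b
     + nform_at a1 (cf (lie (lie (e x1) (e x)) (e y1))) b
     - nform_at a1 (cf (lie (lie (e y1) (e x)) (e x1))) b = 0.
    rewrite -nform_atN -!nform_atD.
    suff -> : cf (lie (lie (e y1) (e x1)) (e x)) + cf (lie (lie (e x1) (e x)) (e y1))
        - cf (lie (lie (e y1) (e x)) (e x1)) = 0 by rewrite nform_at0.
    rewrite -raddfN -!raddfD -[RHS](raddf0 cf); congr (cf _).
    rewrite (lieC (e x) (lie _ _)) (lieC (e y1) (lie _ _)) (lieC (e x1) (lie _ _)).
    rewrite (lieC (e x) (e y1)) lierN !opprK.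
    apply/eqP; rewrite -oppr_eq0 !opprD !opprK; apply/eqP.
    by rewrite -(lie_jacobi (e y1) (e x1) (e x)) [RHS]addrC addrA.
  by apply/eqP; rewrite -subr_eq0 -[X in _ == X]jac; apply/eqP; ring.
move=> [? ? ?]; subst y1' x1' b1 a.
(* Disjoint descents: both sides expand to the four words obtained by reversing
   or bracketing each of the two pairs. *)
have lt_w1 : (straight_measure (a1 ++ [:: x1, y1 & c ++ [:: y, x & b]]) < straight_measure w)%N.
  by apply: swap_lt; rewrite // eq_w1.
have lt_w2 : (straight_measure (a1 ++ [:: y1, x1 & c ++ [:: x, y & b]]) < straight_measure w)%N.
  rewrite -![_ :: _ :: c ++ _]/([:: _; _] ++ c ++ _) !catA.
  by apply: swap_lt; rewrite // -!catA /= eq_w1.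
rewrite eq_n -!catA /= (IH _ lt_w2 a1 y1 x1 _ erefl lt1).
have -> := IH _ lt_w1 (a1 ++ [:: x1, y1 & c]) y x b; rewrite -?catA //=.
have far1 p : nform_at a1 p (c ++ [:: y, x & b])
    = nform_at a1 p (c ++ [:: x, y & b]) + nform_at2 a1 p c (basis_lie y x) b.
  elim/malg_ind: p => [|k z p IHp]; first by rewrite /nform_at2 !lin_form0 !nform_at0 addr0.
  rewrite /nform_at2 lin_formP -/(nform_at2 a1 p c _ b) lin_formU !nform_atP IHp !nform_atU.
  rewrite (IHsize _ _ (a1 ++ z :: c) y x b) -?catA //=.
    by ring.
  by rewrite eq_w1 !size_cat /= !addnS.
have far2 q : nform_at (a1 ++ [:: y1, x1 & c]) q b
    = nform_at (a1 ++ [:: x1, y1 & c]) q b + nform_at2 a1 (basis_lie y1 x1) c q b.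
  rewrite nform_at2C; elim/malg_ind: q => [|k z q IHq]; first by rewrite lin_form0 !nform_at0 addr0.
  rewrite lin_formP lin_formU !nform_atP IHq !nform_atU -!catA /=.
  rewrite (IHsize _ _ a1 y1 x1 (c ++ z :: b)) //.
    by ring.
  by rewrite eq_w1 !size_cat /= !size_cat /= !addnS.
rewrite far1 far2; ring.
Qed.

Lemma nform_comm a x y b :
  nform (a ++ x :: y :: b) - nform (a ++ y :: x :: b) = nform_at a (basis_lie x y) b.
Proof. by apply: straightens_comm => w _; apply: straightens_all. Qed.

End NormalForm.

(** * Linear functionals on the enveloping algebra *)

(** A functional that kills [a x b] for relations [x] and for [a], [b] in a
    spanning set [G] kills the two-sided ideal. *)
Lemma ideal_functional (K : nzRingType) (A : lalgType K) (X G : A -> Prop) (h : A -> K) :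
    (forall c x y, h (c *: x + y) = c * h x + h y) ->
    (forall c (x y : A), c *: (x * y) = x * (c *: y)) ->
    (forall P : A -> Prop, P 0 -> (forall c x y, G x -> P y -> P (c *: x + y)) -> forall x, P x) ->
    (forall a x b, G a -> X x -> G b -> h (a * x * b) = 0) ->
  forall x, x \in ideal_gen X -> h x = 0.
Proof.
move=> h_lin scAr Gind hG x /ideal_genP.
have h0 := scalar0 h_lin.
elim=> [//|a {}x b y Xx _ IH]; rewrite -[_ * x * b]scale1r h_lin {}IH mul1r addr0.
elim/Gind: a => [|c a a' Ga IHa]; first by rewrite !mul0r.
rewrite !mulrDl -!scalerAl h_lin IHa addr0.
elim/Gind: b {IHa} => [|d b b' Gb IHb]; first by rewrite mulr0 h0 mulr0.
by rewrite mulrDr -scAr h_lin mulrDr IHb hG // !mulr0 addr0.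
Qed.

Lemma sandwichD (K : nzRingType) (A : lalgType K) c (p q x y z : A) :
    (forall c (x y : A), c *: (x * y) = x * (c *: y)) ->
  p * (x - (c *: y + z)) * q = - (c *: (p * y * q) + p * z * q) + p * x * q.
Proof. by move=> scAr; rewrite mulrBr mulrBl mulrDr mulrDl -scAr -scalerAl addrC. Qed.

Lemma sandwichB (A : nzRingType) (p q x y z : A) :
  p * (x - y - z) * q = p * x * q + (- (p * y * q) - (p * z * q)).
Proof. by rewrite !(mulrBr, mulrBl) addrA. Qed.

(** A multilinear function of words in [g] that turns commutators into brackets
    is the same thing as a linear functional on the enveloping algebra. *)
Section UeaFunctional.
Variables (K : fieldType) (g : lieType K) (h : seq g -> K).
Hypothesis h_lin : forall a c x y b,
  h (a ++ (c *: x + y) :: b) = c * h (a ++ x :: b) + h (a ++ y :: b).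
Hypothesis h_lie : forall a x y b,
  h (a ++ x :: y :: b) - h (a ++ y :: x :: b) = h (a ++ lie x y :: b).

Let hF (u : {malg K[{fmonom g}]}) : K := lin_form (fun m : {fmonom g} => h m) u.

Lemma free_word (s : seq g) : \prod_(x <- s) free_gen K x = << FMonom s >>.
Proof.
elim: s => [|x s IH]; first rewrite big_nil.
  by apply: (congr1 (fun m => << m >>)); apply/eqP; rewrite fmP fm1.
rewrite big_cons {}IH malgM_def fgmulUU mulr1; congr << _ >>.
by apply/eqP; rewrite fmP fmM fmU.
Qed.

Let hF_linear c x y z : hF (- (c *: y + z) + x) = - (c * hF y + hF z) + hF x.
Proof. by rewrite /hF lin_formD lin_formN lin_formP. Qed.

Let hF_lie x y z : hF (x + (- y - z)) = hF x - hF y - hF z.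
Proof. by rewrite /hF !(lin_formD, lin_formN) addrA. Qed.

Let hF_ideal u : u \in uea_ideal g -> hF u = 0.
Proof.
apply: (@ideal_functional K _ _ (fun u => exists s, u = << FMonom s >>)).
- exact: lin_formP.
- exact: free_scalerAr.
- move=> P P0 PD; apply: malg_ind => // c m x; apply: PD.
  by case: m => s; exists s.
move=> _ x _ [s ->] Xx [s' ->].
have [W [WU WM hW]] : exists W : seq g -> {malg K[{fmonom g}]},
    [/\ forall y : g, << FMonom s >> * free_gen K y * << FMonom s' >> = W [:: y],
        forall y z : g, << FMonom s >> * (free_gen K y * free_gen K z) * << FMonom s' >>
          = W [:: y; z]
      & forall t, hF (W t) = h (s ++ t ++ s')].
  exists (fun t => << FMonom s >> * << FMonom t >> * << FMonom s' >>).
  split=> [y|y z|t].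
  - by rewrite -(free_word [:: y]) big_seq1.
  - by rewrite -(free_word [:: y; z]) big_cons big_seq1.
  by rewrite malgM_def [<<_>> * _]malgM_def !fgmulUU !mulr1 /hF lin_formU !fmM catA.
case: Xx => [c y z|y z].
  rewrite (sandwichD c); last exact: free_scalerAr.
  have -> := congr2 (fun u v => - u + v)
    (congr2 (fun u v => c *: u + v) (WU y) (WU z)) (WU (c *: y + z)).
  by rewrite hF_linear !hW h_lin addNr.
rewrite sandwichB.
have -> := congr2 (fun u v => u + v) (WM y z) (congr2 (fun u v => - u - v) (WM z y) (WU (lie y z))).
by rewrite hF_lie !hW -h_lie; ring.
Qed.

Definition uea_functional (u : uea g) : K := hF (repr u).

Lemma uea_functional_pi u : uea_functional (uea_pi u) = hF u.
Proof.
apply/eqP; rewrite -subr_eq0 /uea_functional /hF -lin_formN -lin_formD; apply/eqP/hF_ideal.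
exact/uea_piP/uea_piK.
Qed.

Lemma uea_functionalP c u v :
  uea_functional (c *: u + v) = c * uea_functional u + uea_functional v.
Proof.
by rewrite -[u]uea_piK -[v]uea_piK -[in LHS]linearZ -raddfD !uea_functional_pi /hF lin_formP.
Qed.

Lemma uea_functional_word s : uea_functional (\prod_(x <- s) uea_in x) = h s.
Proof.
have -> : \prod_(x <- s) uea_in x = uea_pi (\prod_(x <- s) free_gen K x).
  by rewrite rmorph_prod.
by rewrite uea_functional_pi free_word /hF lin_formU.
Qed.

End UeaFunctional.

Lemma uea_ind (K : fieldType) (g : lieType K) (P : uea g -> Prop) :
    P 0 -> (forall c s u, P u -> P (c *: \prod_(x <- s) uea_in x + u)) ->
  forall u, P u.
Proof.
move=> P0 PD u; rewrite -[u]uea_piK; elim/malg_ind: (repr u) => [|c [s] x IHx].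
  by rewrite raddf0.
rewrite linearP -free_word rmorph_prod; exact: PD.
Qed.

Lemma uea_in0 (K : fieldType) (g : lieType K) : uea_in (0 : g) = 0.
Proof.
have [in_lin _] := @uea_in_rep K g.
by have := in_lin (-1) 0 0; rewrite scaler0 addr0 scaleN1r addNr.
Qed.

(** * Functionals extending a character of a subalgebra *)

Section PBW.
Variables (K : fieldType) (g : lieType K) (d : Order.disp_t) (T : orderType d).
Variables (B : choiceType) (rk : B -> T) (e : B -> g) (cf : {linear g -> {malg K[B]}}).
Hypothesis rk_inj : injective rk.
Hypothesis cf_e : forall b, cf (e b) = << b >>.
Hypothesis cfK : forall x, lin_ext e (cf x) = x.

(** The multilinear extension, to words of vectors of [g], of a function of
    words of basis letters. *)
Fixpoint mform (F : seq B -> K) (s : seq g) : K :=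
  if s is x :: s' then lin_form (fun z => mform (fun w => F (z :: w)) s') (cf x) else F [::].

Lemma eq_mform F1 F2 s : F1 =1 F2 -> mform F1 s = mform F2 s.
Proof.
elim: s F1 F2 => [|x s IH] F1 F2 eqF /=; first exact: eqF.
by apply: eq_lin_form => z _; apply: IH => w; apply: eqF.
Qed.

Lemma mform_lin F1 F2 c s :
  mform (fun w => c * F1 w + F2 w) s = c * mform F1 s + mform F2 s.
Proof.
elim: s F1 F2 => //= x s IH F1 F2; rewrite -lin_form_lin.
by apply: eq_lin_form => z _; apply: IH.
Qed.

Lemma mform_sub F1 F2 s : mform (fun w => F1 w - F2 w) s = mform F1 s - mform F2 s.
Proof.
elim: s F1 F2 => //= x s IH F1 F2; rewrite -lin_form_sub.
by apply: eq_lin_form => z _; apply: IH.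
Qed.

Lemma mform_scale F c s : mform (fun w => c * F w) s = c * mform F s.
Proof.
have := mform_lin F F (c - 1) s; rewrite mulrBl mul1r subrK => <-.
by apply: eq_mform => w; ring.
Qed.

Lemma mform_lin_form (C : choiceType) (F : C -> seq B -> K) (p : {malg K[C]}) s :
  mform (fun w => lin_form (F^~ w) p) s = lin_form (fun t => mform (F t) s) p.
Proof.
elim: s F => //= x s IH F.
by rewrite lin_formC; apply: eq_lin_form => z _; rewrite -IH.
Qed.

Lemma mform_linear F a c x y b :
  mform F (a ++ (c *: x + y) :: b) = c * mform F (a ++ x :: b) + mform F (a ++ y :: b).
Proof.
elim: a F => [|z a IH] F /=; first by rewrite linearP lin_formP.
by rewrite -lin_form_lin; apply: eq_lin_form => t _; rewrite IH.
Qed.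

Lemma mform_rcons F s b : mform F (rcons s (e b)) = mform (fun w => F (rcons w b)) s.
Proof.
elim: s F => [|x s IH] F /=; first by rewrite cf_e lin_formU.
by apply: eq_lin_form => z _; rewrite IH.
Qed.

Lemma mform_lie F a x y b :
    (forall a x y b, F (a ++ x :: y :: b) - F (a ++ y :: x :: b)
      = lin_form (fun z => F (a ++ z :: b)) (basis_lie e cf x y)) ->
  mform F (a ++ x :: y :: b) - mform F (a ++ y :: x :: b) = mform F (a ++ lie x y :: b).
Proof.
move=> F_lie; elim: a F F_lie => [|z a IH] F F_lie /=; last first.
  rewrite -lin_form_sub; apply: eq_lin_form => t _; apply: IH => a' x' y' b'.
  exact: (F_lie (t :: a')).
rewrite [X in _ - X]lin_formC -lin_form_sub.
pose N p := lin_form (fun t => mform (fun w => F (t :: w)) b) p.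
transitivity (lin_form (fun z => lin_form (fun u => N (basis_lie e cf z u)) (cf y)) (cf x)).
  apply: eq_lin_form => z _; rewrite -lin_form_sub; apply: eq_lin_form => u _.
  rewrite -mform_sub /N -mform_lin_form; apply: eq_mform => w.
  exact: (F_lie [::]).
rewrite -{2}[x]cfK -{2}[y]cfK -/(N _).
elim/malg_ind: (cf x) => [|c z p IHp].
  by rewrite lin_form0 raddf0 lie0x raddf0 /N lin_form0.
rewrite lin_formP IHp linearP lieDl linearP /N lin_formP -!/(N _); congr (_ * _ + _).
rewrite lin_formU /= lin_extU.
elim/malg_ind: (cf y) => [|c' u q IHq].
  by rewrite lin_form0 raddf0 liex0 raddf0 /N lin_form0.
by rewrite lin_formP IHq linearP lieDr linearP /N lin_formP lin_formU /= lin_extU.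
Qed.

(** The letters in [H] span a subalgebra on which [chi] is a character.  The
    functional equals [chi] on nondecreasing words in [H] and vanishes on the
    other nondecreasing words; since [H] is an upper set, its letters stand at
    the end of a nondecreasing word. *)
Section Character.
Variables (H : pred B) (chi : B -> K).
Hypothesis H_up : forall x y, H x -> (rk x <= rk y)%O -> H y.
Hypothesis H_lie : forall x y, H x -> H y -> {in msupp (basis_lie e cf x y), forall z, H z}.
Hypothesis chi_lie : forall x y, H x -> H y -> lin_form chi (basis_lie e cf x y) = 0.

Let eps w := if all H w then \prod_(b <- w) chi b else 0.
Let F := nform rk e cf eps.

(** Induction along straightening.  A descent inside [a] or inside [u] is
    straightened on both sides.  A descent that straddles the two parts has
    both letters in [H], because [H] is an upper set, so its left letter can be
    moved from [a] to [u]. *)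
Lemma nform_character a u : all H u -> F (a ++ u) = (\prod_(b <- u) chi b) * F a.
Proof.
have [n] := ubnP (straight_measure rk (a ++ u)).
elim: n a u => // n IH a u; rewrite ltnS => lt_n Hu.
have str p y x q : F (p ++ y :: x :: q) - F (p ++ x :: y :: q)
    = nform_at rk e cf eps p (basis_lie e cf y x) q by exact: nform_comm.
have inside p c y x q : a ++ u = p ++ c ++ y :: x :: q -> (rk x < rk y)%O ->
    all H (c ++ y :: x :: q) ->
    F (p ++ c ++ y :: x :: q) = (\prod_(b <- c ++ y :: x :: q) chi b) * F p.
  move=> eq_au lt_xy Hcq; have := Hcq; rewrite all_cat /= => /and4P[Hc Hy Hx Hq].
  have := str (p ++ c) y x q; rewrite -!catA => /(canRL (subrK _)) ->.
  rewrite IH; first last.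
  - by rewrite all_cat /= Hc Hy Hx.
  - rewrite eq_au in lt_n; apply: leq_trans lt_n; rewrite !catA.
    exact: straight_measure_swap.
  rewrite /nform_at (@eq_lin_form _ _ _ (fun z => ((\prod_(b <- c ++ q) chi b) * F p) * chi z)).
    rewrite lin_form_scale chi_lie // mulr0 add0r !big_cat !big_cons /=; ring.
  move=> z zS; rewrite -catA -/(F _) IH ?all_cat /= ?Hc ?Hq ?(H_lie _ _ zS) //.
    by rewrite !big_cat !big_cons /=; ring.
  apply: leq_trans lt_n; rewrite eq_au; apply: straight_measure_size.
  by rewrite !size_cat /= !addnS.
case: (descentP rk (a ++ u)) (erefl (descent rk (a ++ u))) => [p y x q eq_au lt_xy _ _|sorted_au _].
  have [le_ap|lt_pa] := leqP (size a) (size p).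
    have [c eq_p eq_u] := cat_prefix eq_au le_ap.
    by rewrite eq_u; apply: inside; rewrite // -eq_u.
  have [[|y' [|x' c]] eq_a eq_q] := cat_prefix (esym eq_au) (ltnW lt_pa).
  - by rewrite eq_a cats0 ltnn in lt_pa.
  - case: eq_q => eq_y eq_u; subst y'.
    rewrite -eq_u /= in Hu; case/andP: Hu => Hx Hq; have Hy := H_up Hx (ltW lt_xy).
    rewrite eq_au (inside p [::]) //=; last by rewrite Hy Hx.
    rewrite eq_a IH /= ?Hy //; last first.
      apply: leq_trans lt_n; rewrite eq_au; apply: straight_measure_size.
      by rewrite !size_cat /=; lia.
    by rewrite -?eq_u !big_cons big_nil; ring.
  case: eq_q => eq_y eq_x eq_q; subst y' x'.
  have eq2 : F a = F (p ++ x :: y :: c) + nform_at rk e cf eps p (basis_lie e cf y x) c.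
    by rewrite eq_a -str addrC subrK.
  rewrite eq2 eq_au mulrDr.
  have := str p y x q; rewrite eq_q => /(canRL (subrK _)) ->; rewrite addrC.
  rewrite -cat_rcons -cat_rcons catA IH //; last first.
    by apply: leq_trans lt_n; rewrite eq_au eq_q -catA !cat_rcons; exact: straight_measure_swap.
  rewrite !cat_rcons; congr (_ + _).
  rewrite /nform_at -lin_form_scale; apply: eq_lin_form => z _.
  rewrite -cat_cons catA -[LHS]/(F _) IH //.
  apply: leq_trans lt_n; rewrite eq_au eq_q; apply: straight_measure_size.
  by rewrite !size_cat /= !size_cat; lia.
rewrite /F !nform_sorted //; last first.
  by move: sorted_au; rewrite /sorted_word; case: (a) => //= b a'; rewrite cat_path => /andP[].
by rewrite /eps all_cat Hu andbT; case: ifP; rewrite ?mulr0 // big_cat /= mulrC.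
Qed.

Theorem character_functional : exists h : uea g -> K,
  [/\ forall c u v, h (c *: u + v) = c * h u + h v, h 1 = 1
    & forall u b, H b -> h (u * uea_in (e b)) = chi b * h u].
Proof.
have F_lie a x y b := mform_lie a x y b (nform_comm rk_inj cfK eps).
have F_lin := mform_linear F.
have h_lin := uea_functionalP F_lin F_lie.
have h_word := uea_functional_word F_lin F_lie.
exists (uea_functional (mform F)); split=> //.
  have := h_word [::]; rewrite big_nil => -> /=.
  by rewrite /F nform_sorted // /eps /= big_nil.
move=> u b Hb; have h0 := scalar0 h_lin.
elim/uea_ind: u => [|c s u IHu]; first by rewrite mul0r h0 mulr0.
rewrite mulrDl -scalerAl !h_lin IHu mulrDr; congr (_ + _).
have -> : (\prod_(x <- s) uea_in x) * uea_in (e b) = \prod_(x <- rcons s (e b)) uea_in x.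
  by rewrite -cats1 big_cat big_seq1.
rewrite !h_word mform_rcons mulrCA; congr (_ * _); rewrite -mform_scale.
apply: eq_mform => w; rewrite -cats1 -/(F _) nform_character ?big_seq1 //=.
by rewrite Hb.
Qed.

End Character.
End PBW.

(** * Recurrent and exponential-polynomial sequences *)

Section Recurrent.
Variable K : fieldType.
Implicit Types (p q : {poly K}) (a b : int -> K).

(** The action of the polynomial ring on two-sided sequences in which the
    variable shifts the index by one. *)
Definition shiftp p a (n : int) : K := \sum_(i < size p) p`_i * a (n + i%:Z).

Lemma shiftp_widen m p a n : (size p <= m)%N ->
  shiftp p a n = \sum_(i < m) p`_i * a (n + i%:Z).
Proof.
move=> le_pm; rewrite /shiftp (big_ord_widen _ (fun i => p`_i * a (n + i%:Z)) le_pm) big_mkcond.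
by apply: eq_bigr => i _; case: ltnP => // le_pi; rewrite nth_default // mul0r.
Qed.

Lemma shiftpP c p q a n : shiftp (c *: p + q) a n = c * shiftp p a n + shiftp q a n.
Proof.
pose m := maxn (size (c *: p + q)) (maxn (size p) (size q)).
rewrite !(@shiftp_widen m) ?leq_max ?leqnn ?orbT // mulr_sumr -big_split.
by apply: eq_bigr => i _; rewrite coefD coefZ mulrDl mulrA.
Qed.

Lemma shiftp0 a n : shiftp 0 a n = 0.
Proof. by rewrite /shiftp size_poly0 big_ord0. Qed.

Lemma shiftpC c a n : shiftp c%:P a n = c * a n.
Proof. by rewrite (@shiftp_widen 1) ?size_polyC_leq1 // big_ord1 coefC addr0. Qed.

Lemma shiftpMX p a n : shiftp (p * 'X) a n = shiftp p a (n + 1).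
Proof.
rewrite (@shiftp_widen (size p).+1); last by rewrite (leq_trans (size_polyMleq _ _)) ?size_polyX ?addn2.
rewrite big_ord_recl coefMX /= mul0r add0r; apply: eq_bigr => i _.
by rewrite coefMX /= -addrA -PoszD.
Qed.

Lemma shiftpD p q a n : shiftp (p + q) a n = shiftp p a n + shiftp q a n.
Proof. by rewrite -[p]scale1r shiftpP mul1r scale1r. Qed.

Lemma shiftpZ c p a n : shiftp (c *: p) a n = c * shiftp p a n.
Proof. by rewrite -[c *: p]addr0 shiftpP shiftp0 addr0. Qed.

Lemma shiftpM p q a n : shiftp (p * q) a n = shiftp p (shiftp q a) n.
Proof.
elim/poly_ind: p n => [|p c IHp] n; first by rewrite mul0r !shiftp0.
by rewrite mulrDl mulrAC mul_polyC !shiftpD shiftpZ !shiftpMX IHp shiftpC.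
Qed.

Lemma shiftpXsubC r a n : shiftp ('X - r%:P) a n = a (n + 1) - r * a n.
Proof. by rewrite -['X]mul1r -polyCN shiftpD shiftpMX !shiftpC mul1r mulNr. Qed.

Lemma eq_shiftp p a b n : a =1 b -> shiftp p a n = shiftp p b n.
Proof. by move=> eq_ab; apply: eq_bigr => i _; rewrite eq_ab. Qed.

Lemma shiftp_lin p c a b n :
  shiftp p (fun m => c * a m + b m) n = c * shiftp p a n + shiftp p b n.
Proof. by rewrite mulr_sumr -big_split; apply: eq_bigr => i _ /=; ring. Qed.

Lemma shiftp_eq0 p a n : (forall m, a m = 0) -> shiftp p a n = 0.
Proof. by move=> a0; apply: big1 => i _; rewrite a0 mulr0. Qed.

Definition recurrent a := exists2 p, p != 0 & forall n, shiftp p a n = 0.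

Lemma recurrent0 : recurrent (fun=> 0).
Proof. by exists 1; [exact: oner_neq0 | move=> n; apply: shiftp_eq0]. Qed.

Lemma recurrent_common a b : recurrent a -> recurrent b ->
  exists2 p, p != 0 & forall n, shiftp p a n = 0 /\ shiftp p b n = 0.
Proof.
move=> [p p0 pa] [q q0 qb]; exists (p * q); first by rewrite mulf_neq0.
by move=> n; split; [rewrite mulrC|]; rewrite shiftpM; apply: shiftp_eq0.
Qed.

Lemma recurrent_lin c a b : recurrent a -> recurrent b -> recurrent (fun n => c * a n + b n).
Proof.
move=> ra rb; have [p p0 pab] := recurrent_common ra rb; exists p => // n.
by rewrite shiftp_lin; have [-> ->] := pab n; rewrite mulr0 addr0.
Qed.

Lemma recurrent_shiftp p a : p != 0 -> recurrent (shiftp p a) -> recurrent a.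
Proof.
by move=> p0 [q q0 qpa]; exists (q * p); [rewrite mulf_neq0 | move=> n; rewrite shiftpM qpa].
Qed.

Lemma eq_recurrent a b : a =1 b -> recurrent a -> recurrent b.
Proof. by move=> eq_ab [p p0 pa]; exists p => // n; rewrite -(eq_shiftp _ _ eq_ab). Qed.

Definition expmono (k : nat) (r : K) (n : int) : K := n%:~R ^+ k * r ^ n.

Lemma exprS_binomial (x : K) k : (x + 1) ^+ k = x ^+ k + \sum_(j < k) 'C(k, j)%:R * x ^+ j.
Proof.
rewrite addrC exprDn big_ord_recr /= binn expr1n mul1r mulr1n addrC; congr (_ + _).
by apply: eq_bigr => i _; rewrite expr1n mul1r mulr_natl.
Qed.

(** Applying the shift minus [r] to [n^k r^n] leaves a combination of the
    [n^j r^n] with [j < k]. *)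
Lemma recurrent_expmono k r : r != 0 -> recurrent (expmono k r).
Proof.
move=> r0; have [m] := ubnP k; elim: m k => // m IH k lt_km.
apply: (@recurrent_shiftp ('X - r%:P)); first by rewrite polyXsubC_eq0.
have: recurrent (fun n => \sum_(j < k) (r * 'C(k, j)%:R) * expmono j r n).
  suff: forall s : seq 'I_k, recurrent (fun n => \sum_(j <- s) (r * 'C(k, j)%:R) * expmono j r n).
    by apply.
  elim=> [|j s IHs]; first by apply: eq_recurrent recurrent0 => n; rewrite big_nil.
  have rj : recurrent (expmono j r) by apply: IH; apply: leq_trans (ltn_ord j) _.
  by apply: eq_recurrent (recurrent_lin (r * 'C(k, j)%:R) rj IHs) => n; rewrite big_cons.
apply: eq_recurrent => n; rewrite shiftpXsubC /expmono intrD exprS_binomial.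
rewrite expfzDr // expr1z; set S := \sum_(j < k) 'C(k, j)%:R * _.
transitivity (S * (r ^ n * r)); last by ring.
by rewrite /S mulr_suml; apply: eq_bigr => j _; ring.
Qed.

Definition exppoly a := exists2 s : seq (K * nat * K),
  {in s, forall x, x.2 != 0} & forall n, a n = \sum_(x <- s) x.1.1 * expmono x.1.2 x.2 n.

Lemma exppoly_ind (P : (int -> K) -> Prop) :
    (forall a b, a =1 b -> P a -> P b) -> P (fun=> 0) ->
    (forall c k r b, r != 0 -> P b -> P (fun n => c * expmono k r n + b n)) ->
  forall a, exppoly a -> P a.
Proof.
move=> Pext P0 PD a [s s0 aE]; suff: P (fun n => \sum_(x <- s) x.1.1 * expmono x.1.2 x.2 n).
  by apply: Pext => n.
elim: s s0 {aE} => [|x s IH] s0; first by apply: Pext P0 => n; rewrite big_nil.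
apply: (Pext _ _ _ (PD x.1.1 x.1.2 x.2 _ _ (IH _))) => [n||y ys]; first by rewrite big_cons.
  by apply: s0; rewrite mem_head.
by apply: s0; rewrite inE ys orbT.
Qed.

Lemma exppoly_recurrent a : exppoly a -> recurrent a.
Proof.
elim/exppoly_ind => [b b' eq_b|| c k r b r0 IH]; first exact: eq_recurrent.
  exact: recurrent0.
exact: recurrent_lin (recurrent_expmono k r0) IH.
Qed.

Lemma eq_exppoly a b : a =1 b -> exppoly a -> exppoly b.
Proof. by move=> eq_ab [s s0 aE]; exists s => // n; rewrite -eq_ab. Qed.

Lemma exppoly0 : exppoly (fun=> 0).
Proof. by exists [::] => // n; rewrite big_nil. Qed.

Lemma exppoly_expmono k r : r != 0 -> exppoly (expmono k r).
Proof.
by move=> r0; exists [:: (1, k, r)] => [x|n]; rewrite ?inE ?big_seq1 ?mul1r // => /eqP->.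
Qed.

Lemma exppoly_lin c a b : exppoly a -> exppoly b -> exppoly (fun n => c * a n + b n).
Proof.
move=> [s s0 aE] [t t0 bE]; exists ([seq (c * x.1.1, x.1.2, x.2) | x <- s] ++ t).
  by move=> x; rewrite mem_cat => /orP[/mapP[y ys ->] /=|/t0 //]; apply: s0.
move=> n; rewrite big_cat big_map /= aE bE mulr_sumr; congr (_ + _).
by apply: eq_bigr => x _; rewrite mulrA.
Qed.

Lemma exppoly_scale c a : exppoly a -> exppoly (fun n => c * a n).
Proof. by move=> ea; apply: eq_exppoly (exppoly_lin c ea exppoly0) => n; rewrite addr0. Qed.

Lemma exppoly_sum (I : Type) (s : seq I) (c : I -> K) (F : I -> int -> K) :
  (forall i, exppoly (F i)) -> exppoly (fun n => \sum_(i <- s) c i * F i n).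
Proof.
move=> eF; elim: s => [|i s IHs]; first by apply: eq_exppoly exppoly0 => n; rewrite big_nil.
by apply: eq_exppoly (exppoly_lin (c i) (eF i) IHs) => n; rewrite big_cons.
Qed.

Lemma exppoly_mulexp r a : r != 0 -> exppoly a -> exppoly (fun n => r ^ n * a n).
Proof.
move=> r0; elim/exppoly_ind => [b b' eq_b|| c k t b t0 IH].
- by apply: eq_exppoly => n; rewrite eq_b.
- by apply: eq_exppoly exppoly0 => n; rewrite mulr0.
apply: eq_exppoly (exppoly_lin c (exppoly_expmono k (mulf_neq0 r0 t0)) IH) => n.
by rewrite /expmono expfzMl //; ring.
Qed.
Lemma exppoly_shift a : exppoly a -> exppoly (fun n => a (n - 1)).
Proof.
elim/exppoly_ind => [b b' eq_b|| c k r b r0 IH].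
- by apply: eq_exppoly => n; rewrite eq_b.
- by apply: eq_exppoly exppoly0 => n.
apply: eq_exppoly (exppoly_lin (c / r) (exppoly_sum (index_enum 'I_k.+1)
  (fun j : 'I_k.+1 => (-1) ^+ (k - j) *+ 'C(k, j)) (fun j => exppoly_expmono j r0)) IH) => n /=.
congr (_ + _); have rn : r ^ n = r ^ (n - 1) * r.
  by rewrite -[r in RHS]expr1z -expfzDr // subrK.
set S := \sum_(j <- _) _; have -> : S = (-1 + n%:~R) ^+ k * r ^ n.
  by rewrite exprDn mulr_suml; apply: eq_bigr => j _; rewrite /expmono mulrA mulrnAl.
by rewrite rn /expmono intrD mulrN1z addrC; field.
Qed.

(** The difference operator is onto.  The difference of
    [n^(k+1) / (k+1)], or of [n^k r^n / (r-1)] when [r <> 1], is [n^k r^n] up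
    to terms of lower degree, which are treated by induction. *)
Lemma exppoly_primitive a : (forall n, n.+1%:R != 0 :> K) -> exppoly a ->
  exists2 b, exppoly b & forall n, b (n + 1) - b n = a n.
Proof.
move=> char0; elim/exppoly_ind => [b b' eq_b [f ef fE]||c k r b r0 [f ef fE]].
- by exists f => // n; rewrite fE.
- by exists (fun=> 0) => [|n]; [exact: exppoly0 | rewrite subr0].
suff [h eh hE]: exists2 h, exppoly h & forall n, h (n + 1) - h n = expmono k r n.
  exists (fun n => c * h n + f n); first exact: exppoly_lin.
  by move=> n; rewrite -fE -hE; ring.
have [m] := ubnP k; elim: m k {b f ef fE} => // m IH k lt_km.
have sub_lower (d : nat -> K) : exists2 h, exppoly h
    & forall n, h (n + 1) - h n = \sum_(j < k) d j * expmono j r n.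
  elim: k lt_km => [|k IHk] lt_km.
    by exists (fun=> 0) => [|n]; [exact: exppoly0 | rewrite big_ord0 subr0].
  have [h eh hE] := IHk (ltnW lt_km); have [h1 eh1 h1E] := IH k lt_km.
  exists (fun n => d k * h1 n + h n); first exact: exppoly_lin.
  by move=> n; rewrite big_ord_recr /= -hE -h1E; ring.
have [r1|r1] := eqVneq r 1.
  have [h eh hE] := sub_lower (fun j => 'C(k.+1, j)%:R).
  exists (fun n => (- k.+1%:R^-1) * h n + k.+1%:R^-1 * expmono k.+1 r n).
    exact/exppoly_lin/exppoly_scale/exppoly_expmono.
  move=> n; have [d dE] : exists d, d = h (n + 1) - h n by exists (h (n + 1) - h n).
  rewrite hE in dE; have hE1 : h (n + 1) = h n + d by rewrite dE -hE; ring.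
  rewrite hE1 /expmono !r1 !exp1rz !mulr1 intrD exprS_binomial big_ord_recr /=.
  rewrite binSn.
  have -> : \sum_(j < k) 'C(k.+1, j)%:R * n%:~R ^+ j = d.
    by rewrite dE; apply: eq_bigr => j _; rewrite /expmono r1 exp1rz mulr1.
  by field; rewrite addrC natr1.
have [h eh hE] := sub_lower (fun j => 'C(k, j)%:R).
have r1' : r - 1 != 0 by rewrite subr_eq0.
exists (fun n => (- (r / (r - 1))) * h n + (r - 1)^-1 * expmono k r n).
  exact/exppoly_lin/exppoly_scale/exppoly_expmono.
move=> n; have [d dE] : exists d, d = h (n + 1) - h n by exists (h (n + 1) - h n).
rewrite hE in dE; have hE1 : h (n + 1) = h n + d by rewrite dE -hE; ring.
rewrite hE1 /expmono intrD exprS_binomial expfzDr // expr1z.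
have -> : d = (\sum_(j < k) 'C(k, j)%:R * n%:~R ^+ j) * r ^ n.
  by rewrite dE mulr_suml; apply: eq_bigr => j _; rewrite /expmono mulrA.
by field.
Qed.

Lemma int_const a : (forall n, a (n + 1) = a n) -> forall n, a n = a 0.
Proof.
move=> aS; elim/int_rec => // n IH.
  by rewrite -addn1 PoszD aS.
by rewrite -IH -(aS (- n.+1%:Z)) -addn1 PoszD opprD subrK.
Qed.

(** For [r <> 0] the equation [a (n+1) - r * a n = e n] becomes, for the
    sequence [r^-n a n], the inversion of the difference operator, whose kernel
    consists of constants.  For [r = 0] the sequence [a] is a shift of [e]. *)
Lemma exppoly_XsubC r a : (forall n, n.+1%:R != 0 :> K) ->
  exppoly (shiftp ('X - r%:P) a) -> exppoly a.
Proof.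
move=> char0 e_ra; have [r0|r0] := eqVneq r 0.
  apply: eq_exppoly (exppoly_shift e_ra) => n.
  by rewrite shiftpXsubC r0 mul0r subr0 subrK.
have ri : r^-1 != 0 by rewrite invr_eq0.
have [f ef fE] := exppoly_primitive char0 (exppoly_scale r^-1 (exppoly_mulexp ri e_ra)).
have const := @int_const (fun n => r^-1 ^ n * a n - f n).
apply: (@eq_exppoly (fun n => (a 0 - f 0) * expmono 0 r n + r ^ n * f n)); last first.
  by apply: exppoly_lin; [apply: exppoly_expmono | apply: exppoly_mulexp].
move=> n; have rn : r ^ n != 0 by rewrite expfz_neq0.
have /(canRL (subrK _)) : r^-1 ^ n * a n - f n = a 0 - f 0.
  rewrite const; first by rewrite expr0z mul1r.
  move=> m; apply/eqP; rewrite -subr_eq0; apply/eqP.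
  have := fE m; rewrite shiftpXsubC => /(canRL (subrK _)) ->.
  by rewrite expfzDr // expr1z; field.
rewrite exprz_inv -invr_expz /expmono expr0 mul1r [_ * f n]mulrC -mulrDl => <-.
by rewrite mulrC mulVKf.
Qed.

End Recurrent.

Section ClosedField.
Variable K : numClosedFieldType.

(** Over a closed field the annihilating polynomial is a product of linear
    factors, which are removed one at a time. *)
Theorem recurrent_exppoly (a : int -> K) : recurrent a <-> exppoly a.
Proof.
split=> [[p p0 pa]|]; last exact: exppoly_recurrent.
have char0 n : n.+1%:R != 0 :> K by rewrite pnatr_eq0.
have [rs pE] := closed_field_poly_normal p.
have {pa}: exppoly (shiftp (\prod_(z <- rs) ('X - z%:P)) a).
  apply: eq_exppoly (exppoly0 K) => n; have := pa n; rewrite pE shiftpZ => /eqP.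
  by rewrite mulf_eq0 lead_coef_eq0 (negPf p0) /= => /eqP.
elim: rs {p p0 pE} a => [|r rs IH] a.
  by rewrite big_nil; apply: eq_exppoly => n; rewrite -[1]/(1%:P) shiftpC mul1r.
rewrite big_cons => ea; apply: IH; apply: (exppoly_XsubC char0 (r := r)).
by apply: eq_exppoly ea => n; rewrite shiftpM.
Qed.

End ClosedField.

Lemma exp_polynomialE (K : fieldType) (chi : {linear laurent K -> K^o}) :
  exp_polynomial chi <-> exppoly (fun n => chi (tpow K n) : K).
Proof.
split=> [[c [m [s [_ s0 chiE]]]]|[t t0 chiE]].
  exists [seq (c k l, k, l) | k <- iota 0 m, l <- s].
    by move=> x /allpairsP[[k l] [_ ls ->]] /=; apply: contraNneq s0 => <-.
  move=> n; rewrite chiE big_allpairs_dep -[in iota 0 m](subn0 m) -/(index_iota 0 m) big_mkord.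
  by apply: eq_bigr => k _; apply: eq_bigr => l _; rewrite /expmono mulrA.
exists (fun k l => \sum_(x <- t | (x.1.2 == k) && (x.2 == l)) x.1.1),
  (\max_(x <- t) x.1.2).+1, (undup [seq x.2 | x <- t]).
split=> [||n]; first exact: undup_uniq.
  by rewrite mem_undup; apply/mapP => -[x /t0 x0 xE]; rewrite -xE eqxx in x0.
rewrite chiE; have lt_m x : x \in t -> (x.1.2 < (\max_(x <- t) x.1.2).+1)%N.
  by move=> xt; rewrite ltnS; apply: leq_bigmax_seq.
move: (_.+1) lt_m => m lt_m; pose s := undup [seq x.2 | x <- t].
transitivity (\sum_(x <- t) \sum_(k < m) \sum_(l <- s)
    if (x.1.2 == k) && (x.2 == l) then x.1.1 * n%:~R ^+ k * l ^ n else 0); last first.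
  rewrite exchange_big; apply: eq_bigr => k _; rewrite exchange_big; apply: eq_bigr => l _ /=.
  by rewrite -mulrA mulr_suml [RHS]big_mkcond; apply: eq_bigr => x _; rewrite mulrA.
rewrite big_seq_cond [RHS]big_seq_cond; apply: eq_bigr => x /andP[xt _].
have lt_x := lt_m x xt.
rewrite (bigD1 (Ordinal lt_x)) //= [X in _ + X]big1 ?addr0; last first.
  move=> k; rewrite -val_eqE /= eq_sym => /negPf kx; apply: big1 => l _.
  by rewrite kx.
rewrite /s (bigD1_seq x.2) ?undup_uniq ?mem_undup ?map_f //= [X in _ + X]big1 ?addr0; last first.
  by move=> l; rewrite eq_sym => /negPf lx; rewrite lx andbF.
by rewrite !eqxx /= mulrA.
Qed.

(** * Dual families of linear functionals *)

Section DualBasis.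
Variables (K : fieldType) (V : lmodType K) (I : eqType) (ell : I -> V -> K).
Hypothesis ell_lin : forall i c x y, ell i (c *: x + y) = c * ell i x + ell i y.

(** Linearly independent functionals admit a dual family of vectors: project
    along the dual family of all but one functional; the remaining one cannot
    vanish on the projections. *)
Lemma dual_basis (s : seq I) : uniq s ->
    (forall p : I -> K, (forall x, \sum_(i <- s) p i * ell i x = 0) -> {in s, forall i, p i = 0}) ->
  exists f : I -> V, {in s &, forall i j, ell i (f j) = (i == j)%:R}.
Proof.
elim: s => [|k s IH] /=; first by exists (fun=> 0).
move=> /andP[kNs s_uniq] indep.
have indep_s (p : I -> K) : (forall x, \sum_(i <- s) p i * ell i x = 0) -> {in s, forall i, p i = 0}.
  move=> ps0 i si; have ik : i != k by apply: contraNneq kNs => <-.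
  have := indep (fun j => if j == k then 0 else p j); rewrite /= => /(_ _ i).
  rewrite (negPf ik) inE si orbT; apply=> // x.
  rewrite big_cons eqxx mul0r add0r -[RHS](ps0 x); apply: eq_big_seq => j js.
  by case: eqP js => // -> ; rewrite (negPf kNs).
have [f fE] := IH s_uniq indep_s.
have ell_sum i (c : I -> K) t : ell i (\sum_(j <- t) c j *: f j) = \sum_(j <- t) c j * ell i (f j).
  elim: t => [|j t IHt]; last by rewrite !big_cons ell_lin IHt.
  by rewrite !big_nil (scalar0 (ell_lin i)).
pose proj x := (-1) *: (\sum_(j <- s) ell j x *: f j) + x.
have projs x i : i \in s -> ell i (proj x) = 0.
  move=> si; rewrite ell_lin ell_sum (bigD1_seq i) //= fE // eqxx mulr1 big_seq_cond.
  rewrite big1 ?addr0 ?mulN1r ?addNr // => j /andP[js ji].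
  by rewrite fE // eq_sym (negPf ji) mulr0.
have [x xk] : exists x, ell k (proj x) != 0.
  apply: contrapT => no_x; suff /eqP : (-1 : K) = 0 by rewrite oppr_eq0 oner_eq0.
  pose p i := if i == k then -1 else ell k (f i).
  have := indep p _ k (mem_head k s); rewrite /p eqxx; apply=> x.
  apply/eqP; apply: contraT => nz; case: no_x; exists x.
  apply: contraNneq nz; rewrite ell_lin ell_sum big_cons eqxx mulN1r mulN1r => e0.
  move/eqP: e0; rewrite addrC subr_eq0 => /eqP ->; rewrite addrC subr_eq0; apply/eqP.
  apply: eq_big_seq => j js; rewrite mulrC; case: eqP js => // ->.
  by rewrite (negPf kNs).
pose y := (ell k (proj x))^-1 *: proj x + 0.
have ell0 i : ell i 0 = 0 by exact: scalar0 (ell_lin i).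
have yk : ell k y = 1 by rewrite ell_lin ell0 addr0 mulVf.
have ys i : i \in s -> ell i y = 0.
  by move=> si; rewrite ell_lin ell0 addr0 (projs x i si) mulr0.
exists (fun j => if j == k then y else (- ell k (f j)) *: y + f j).
move=> i j; rewrite !inE => /predU1P[->|si] /predU1P[->|sj]; rewrite ?eqxx ?yk ?ys //.
- case: eqP sj => [->|jk]; first by rewrite (negPf kNs).
  by move=> sj; rewrite ell_lin yk mulr1 addNr; case: eqP => // kj; case: jk.
- by case: eqP si => // ->; rewrite (negPf kNs).
case: eqP sj => [->|_ sj]; first by rewrite (negPf kNs).
by rewrite ell_lin ys // mulr0 add0r fE.
Qed.

End DualBasis.

Section RecurrentDual.
Variables (K : fieldType) (c : int -> K).

(** A linear relation between the functionals [q |-> sum_j q_j c (j + i)], for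
    [i] in [s], is a recurrence for [c]; the negative exponents are shifted
    away by the minimum of [s]. *)
Lemma not_recurrent_dual (s : seq int) (k : int) : ~ recurrent c -> uniq s -> k \in s ->
  exists q : {malg K[int]}, {in s, forall i, lin_form (fun j => c (j + i)) q = (i == k)%:R}.
Proof.
move=> nrec s_uniq ks.
pose ell i (q : {malg K[int]}) := lin_form (fun j => c (j + i)) q.
have ell_lin i a (x y : {malg K[int]}) : ell i (a *: x + y) = a * ell i x + ell i y.
  exact: lin_formP.
have [|f fE] := dual_basis ell_lin s_uniq; last by exists (f k) => i si; apply: fE.
move=> p p0 i0 si0; apply/eqP; apply: contraT => pi0; case: nrec.
(* Only [l <= i] for all [i] in [s] matters, so including 0 is harmless. *)
pose l := foldr Num.min 0 s.
have le_l i : i \in s -> l <= i.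
  rewrite /l; elim: (s) => //= j t IH; rewrite inE ge_min => /predU1P[->|/IH ->].
    by rewrite lexx.
  by rewrite orbT.
have absE i : i \in s -> `|i - l|%N%:Z = i - l by move=> /le_l; lia.
exists (\sum_(i <- s) p i *: 'X^`|i - l|%N).
  apply: contraNneq pi0 => /(congr1 (fun P : {poly K} => P`_`|i0 - l|%N)).
  rewrite coef0 coef_sum (bigD1_seq i0) //= coefZ coefXn eqxx mulr1.
  rewrite big_seq_cond big1 ?addr0 => [->//|i /andP[si ii0]].
  rewrite coefZ coefXn; case: eqP => [e|]; rewrite ?mulr0 //.
  by case/eqP: ii0; have := absE _ si; have := absE _ si0; lia.
move=> n; rewrite -[RHS](p0 << n - l >>).
have -> (t : seq int) : shiftp (\sum_(i <- t) p i *: 'X^`|i - l|%N) c n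
    = \sum_(i <- t) p i * c (n + `|i - l|%N%:Z).
  elim: t => [|i t IHt]; first by rewrite !big_nil shiftp0.
  rewrite !big_cons shiftpP IHt; congr (_ * _ + _).
  elim: (`|i - l|%N) n {IHt} => [|m IHm] n; first by rewrite expr0 -[1]/(1%:P) shiftpC mul1r addr0.
  by rewrite exprSr shiftpMX IHm -addrA -PoszD.
apply: eq_big_seq => i si; rewrite /ell lin_formU absE //; congr (_ * c _); ring.
Qed.

End RecurrentDual.

(** * The Whittaker vector *)

Section UeaLift.
Variables (K : fieldType) (g : lieType K) (A : algType K) (f : g -> A) (f_rep : assoc_rep f).

Lemma uea_liftM u u' : uea_lift f_rep (u * u') = uea_lift f_rep u * uea_lift f_rep u'.
Proof. exact: rmorphM. Qed.

Lemma uea_liftP c u u' : uea_lift f_rep (c *: u + u') = c *: uea_lift f_rep u + uea_lift f_rep u'.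
Proof. exact: linearP. Qed.

End UeaLift.

Section LoopVirasoroGeFacts.
Variables (K : fieldType) (N : nat).
Local Notation L := (loopvir K).
Local Notation ge_span := (Defs.span (@loopvir_ge_gen K N)).

Definition ge_letter (b : option int * int) : bool := if b.1 is Some i then N%:Z <= i else true.

Lemma ge_letter_gen b : ge_letter b -> @loopvir_ge_gen K N << b >>.
Proof. by case: b => [[i|] k] //= Ni; [exact: loopvir_ge_dt | exact: loopvir_ge_ct]. Qed.

Lemma ge_gen_letter x : @loopvir_ge_gen K N x -> exists2 b, ge_letter b & x = << b >>.
Proof. by case=> [i k Ni|k]; [exists (Some i, k) | exists (None, k)]. Qed.

Lemma dt_ge_span i k : N%:Z <= i -> dt K i k \in ge_span.
Proof. by move=> Ni; apply/mem_span/loopvir_ge_dt. Qed.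

Lemma ct_ge_span k : ct K k \in ge_span.
Proof. exact/mem_span/loopvir_ge_ct. Qed.

Lemma ge_span_ind (P : L -> Prop) : P 0 ->
  (forall c b x, ge_letter b -> x \in ge_span -> P x -> P (c *: << b >> + x)) ->
  forall x, x \in ge_span -> P x.
Proof.
move=> P0 PD x /spanP; elim=> // c y z /ge_gen_letter[b bge ->] /spanP zS Pz.
exact: PD.
Qed.

Lemma ge_span_supp x b : x \in ge_span -> x@_b != 0 -> ge_letter b.
Proof.
elim/ge_span_ind: x / => [|c b' x b'ge _ IH]; first by rewrite mcoeff0 eqxx.
rewrite mcoeffD mcoeffZ mcoeffU; case: (b' =P b) => [<- //|_].
by rewrite mulr0 add0r.
Qed.

End LoopVirasoroGeFacts.

Section Whittaker.
Variables (K : fieldType) (N : nat) (phi : {lie loopvir_ge K N -> K^o}).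
Local Notation L := (loopvir K).
Local Notation ge_span := (Defs.span (@loopvir_ge_gen K N)).
Local Notation W := (whittaker_module phi).

(** [phi] as a function on the whole algebra, with value 0 outside of the
    subalgebra. *)
Definition phi_ext (x : L) : K := oapp (phi : loopvir_ge K N -> K) 0 (insub x).

Lemma phi_ext_incl (y : loopvir_ge K N) : phi_ext (loopvir_ge_incl y) = phi y.
Proof. by rewrite /phi_ext /loopvir_ge_incl valK. Qed.

Lemma ge_spanP x : x \in ge_span -> exists y : loopvir_ge K N, x = loopvir_ge_incl y.
Proof. by move=> xS; exists (LoopvirGe xS). Qed.

Lemma phi_extP c x y : x \in ge_span -> y \in ge_span ->
  phi_ext (c *: x + y) = c * phi_ext x + phi_ext y.
Proof.
move=> /ge_spanP[x' ->] /ge_spanP[y' ->].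
by rewrite -linearP !phi_ext_incl linearP.
Qed.

Lemma phi_ext0 : phi_ext 0 = 0.
Proof. by rewrite -(raddf0 (@loopvir_ge_incl K N)) phi_ext_incl raddf0. Qed.

Lemma phi_ext_lie x y : x \in ge_span -> y \in ge_span -> phi_ext (lie x y) = 0.
Proof.
by move=> /ge_spanP[x' ->] /ge_spanP[y' ->]; rewrite -lie_morph phi_ext_incl lie_morph.
Qed.

Lemma phi_ext_lin_form (chi : option int * int -> K) x :
    (forall b, ge_letter N b -> chi b = phi_ext << b >>) -> x \in ge_span ->
  lin_form chi x = phi_ext x.
Proof.
move=> chiE; elim/ge_span_ind: x / => [|c b x bge xS IH]; first by rewrite lin_form0 phi_ext0.
rewrite lin_formP lin_formU IH chiE // phi_extP //; exact/mem_span/ge_letter_gen.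
Qed.

Let line : lmodType (uea (loopvir_ge K N)) := Defs_whittaker_line__canonical__GRing_Lmodule phi.
Let line1 : line := (1 : K).

Lemma uea_inclZ (c : K) u : uea_incl (c *: u) = c *: @uea_incl K N u.
Proof. exact: (linearZ_LR (uea_lift (incl_rep K N))). Qed.

Lemma uea_inclM u u' : uea_incl (u * u') = uea_incl u * @uea_incl K N u'.
Proof. exact: rmorphM. Qed.

Lemma uea_inclD u u' : uea_incl (u + u') = uea_incl u + @uea_incl K N u'.
Proof. exact: raddfD. Qed.

Lemma uea_incl_in (y : loopvir_ge K N) : uea_incl (uea_in y) = uea_in (loopvir_ge_incl y).
Proof. exact: uea_lift_in. Qed.

Let lineE (z : line) : z = ((z : K)%:A : uea (loopvir_ge K N)) *: line1.
Proof.
rewrite /GRing.scale /= /whittaker_scale /line1 mulr1.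
by rewrite linearZ_LR rmorph1 /= /GRing.scale /= mulr1.
Qed.

Definition whit_vec : W := tens (@uea_incl K N) 1 line1.
Local Notation v := whit_vec.

Lemma whit_vec_tens u (z : line) : tens (@uea_incl K N) u z = ((z : K) *: u) *: v :> W.
Proof.
rewrite [in LHS](lineE z) -tens_balanced [RHS]tens_scale mulr1 /= uea_inclZ rmorph1.
by rewrite -scalerAr mulr1.
Qed.

Lemma whit_vec_gen (w : W) : exists u : uea L, w = u *: v.
Proof.
have [s ->] := tens_gen w; elim: s => [|p s [u IHs]].
  by exists 0; rewrite big_nil scale0r.
exists ((p.2 : K) *: p.1 + u); rewrite big_cons IHs scalerDl.
by rewrite -whit_vec_tens.
Qed.

Lemma whit_vecE x : x \in ge_span -> uea_in x *: v = (phi_ext x)%:A *: v.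
Proof.
move=> /ge_spanP[y ->]; rewrite phi_ext_incl -uea_incl_in.
rewrite [LHS]tens_scale mulr1 -[X in tens _ X _]mul1r tens_balanced.
have yE : (uea_in y *: line1 : K) = phi y.
  exact: etrans (whittaker_lineE phi y (1 : K)) (mulr1 _).
by apply: etrans (whit_vec_tens _ _) _; rewrite yE.
Qed.

(** The universal property of the tensor product: functionals on [U(L)] that
    transform by [phi] under right multiplication by the subalgebra descend to
    functionals on [W]. *)
Lemma whit_functional (h : uea L -> K) :
    (forall c u u', h (c *: u + u') = c * h u + h u') ->
    (forall u b, ge_letter N b -> h (u * uea_in (<< b >> : L)) = phi_ext << b >> * h u) ->
  exists k : {additive W -> K}, forall u, k (u *: v) = h u.
Proof.
move=> h_lin h_ge.
have hD u u' : h (u + u') = h u + h u' by rewrite -[u]scale1r h_lin mul1r scale1r.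
have h0 := scalar0 h_lin.
have hZ c u : h (c *: u) = c * h u by rewrite -[c *: u]addr0 h_lin h0 addr0.
have [in_lin _] := @uea_in_rep K L.
have h_span u x : x \in ge_span -> h (u * uea_in x) = phi_ext x * h u.
  elim/ge_span_ind: x / => [|c b x bge xS IH].
    by rewrite uea_in0 mulr0 h0 phi_ext0 mul0r.
  rewrite in_lin mulrDr -scalerAr h_lin h_ge // IH phi_extP //; first by ring.
  exact/mem_span/ge_letter_gen.
have h_incl u a : h (u * uea_incl a) = uea_lift (whittaker_rep phi) a * h u.
  elim/uea_ind: a => [|c s a IHa]; first by rewrite !raddf0 mulr0 h0 mul0r.
  set a1 := \prod_(x <- s) _; have a1E : h (u * uea_incl a1) = uea_lift (whittaker_rep phi) a1 * h u.
    rewrite {}/a1 {IHa}; elim: s u => [|y s IHs] u.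
      by rewrite big_nil !rmorph1 mulr1 mul1r.
    rewrite big_cons uea_inclM uea_liftM mulrA IHs uea_incl_in.
    rewrite h_span; last exact: loopvir_ge_mem.
    by rewrite phi_ext_incl uea_lift_in mulrCA mulrA.
  have ca1E : h (u * uea_incl (c *: a1)) = c * (uea_lift (whittaker_rep phi) a1 * h u).
    by rewrite uea_inclZ -scalerAr hZ a1E.
  rewrite uea_inclD uea_liftP mulrDr hD; apply: etrans (congr2 +%R ca1E IHa) _.
  by rewrite mulrA -mulrDl.
have [|||k kE] := @tens_univ _ _ (@uea_incl K N) line K (fun u z => h u * (z : K)).
- by move=> u u' z; rewrite hD mulrDl.
- by move=> u z z'; rewrite mulrDr.
- move=> u a z; rewrite h_incl -mulrA mulrCA; congr (_ * _).
exists k => u; rewrite [_ *: _]tens_scale mulr1 kE.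
exact: mulr1.
Qed.

End Whittaker.

(** * Adjoining an element to the subalgebra *)

(** The subalgebra is enlarged by a vector [P] that takes the place of the basis
    vector indexed by [b0].  The hypothesis [P_ge] allows the degenerate case in
    which [P] is already a basis vector of the subalgebra. *)
Section Adjoin.
Variables (K : fieldType) (N : nat) (phi : {lie loopvir_ge K N -> K^o}).
Local Notation L := (loopvir K).
Local Notation B := (option int * int)%type.
Local Notation ge_span := (Defs.span (@loopvir_ge_gen K N)).
Local Notation W := (whittaker_module phi).
Variables (P : L) (b0 : B) (alpha : K).
Hypothesis P_b0 : P@_b0 = 1.
Hypothesis P_ge : ge_letter N b0 -> P = << b0 >> /\ alpha = phi_ext phi P.
Hypothesis P_lie : forall b, ge_letter N b ->
  lie P << b >> \in ge_span /\ phi_ext phi (lie P << b >>) = 0.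

Definition adjoin_basis (b : B) : L := if b == b0 then P else << b >>.
Definition adjoin_coord (x : L) : {malg K[B]} := x - x@_b0 *: (P - << b0 >>).

Lemma adjoin_coord_linear : linear adjoin_coord.
Proof.
move=> c x y; rewrite /adjoin_coord mcoeffD mcoeffZ scalerDl -scalerA opprD addrACA.
by rewrite -scalerBr.
Qed.

HB.instance Definition _ :=
  GRing.isLinear.Build K L {malg K[B]} *:%R adjoin_coord adjoin_coord_linear.

Lemma adjoin_coord_basis b : adjoin_coord (adjoin_basis b) = << b >>.
Proof.
rewrite /adjoin_coord /adjoin_basis; case: (b =P b0) => [->|/eqP bb0].
  by rewrite P_b0 scale1r opprB addrC subrK.
by rewrite mcoeffU (negPf bb0) scale0r subr0.
Qed.

Lemma adjoin_coordK x : lin_ext adjoin_basis (adjoin_coord x) = x.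
Proof.
have extE y : lin_ext adjoin_basis y = y + y@_b0 *: (P - << b0 >>).
  elim/malg_ind: y => [|c b y IHy]; first by rewrite raddf0 mcoeff0 scale0r addr0.
  rewrite linearP /= lin_extU IHy mcoeffD mcoeffZ mcoeffU scalerDl -scalerA addrACA.
  congr (_ + _); rewrite -scalerDr; congr (_ *: _).
  rewrite /adjoin_basis; case: (b =P b0) => [->|_]; last by rewrite scale0r addr0.
  by rewrite scale1r addrC subrK.
rewrite extE /adjoin_coord mcoeffB mcoeffZ mcoeffB P_b0 mcoeffUU subrr mulr0 subr0.
by rewrite subrK.
Qed.

Definition adjoin_letter b := (b == b0) || ge_letter N b.

(** Letters of the enlarged subalgebra get nonnegative ranks and the others
    negative ones, so the former are an upper set. *)
Definition adjoin_rank (b : B) : int :=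
  if adjoin_letter b then (choice.pickle b)%:Z else - (choice.pickle b).+1%:Z.

Lemma adjoin_rank_inj : injective adjoin_rank.
Proof.
move=> b b'; rewrite /adjoin_rank; do 2![case: ifP => _] => e.
- by apply: (pcan_inj choice.pickleK); lia.
- lia.
- lia.
by apply: (pcan_inj choice.pickleK); lia.
Qed.

Lemma adjoin_rank_up b b' : adjoin_letter b -> (adjoin_rank b <= adjoin_rank b')%O -> adjoin_letter b'.
Proof. by rewrite /adjoin_rank => ->; case: ifP => // _; lia. Qed.

Lemma adjoin_coord_ge x : x \in ge_span -> adjoin_coord x = x.
Proof.
move=> xS; rewrite /adjoin_coord; case: (eqVneq x@_b0 0) => [->|xb0].
  by rewrite scale0r subr0.
by have [-> _] := P_ge (ge_span_supp xS xb0); rewrite subrr scaler0 subr0.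
Qed.

Definition adjoin_char b : K := if b == b0 then alpha else phi_ext phi << b >>.

Lemma adjoin_char_ge x : x \in ge_span -> lin_form adjoin_char (adjoin_coord x) = phi_ext phi x.
Proof.
move=> xS; rewrite adjoin_coord_ge // (@phi_ext_lin_form _ N phi) // => b bge; rewrite /adjoin_char.
by case: eqP bge => // -> /P_ge[<- ->].
Qed.

Lemma adjoin_lie b b' : adjoin_letter b -> adjoin_letter b' ->
  lie (adjoin_basis b) (adjoin_basis b') \in ge_span
  /\ phi_ext phi (lie (adjoin_basis b) (adjoin_basis b')) = 0.
Proof.
have geS b1 : ge_letter N b1 -> (<< b1 >> : L) \in ge_span by move=> ?; exact/mem_span/ge_letter_gen.
rewrite /adjoin_letter /adjoin_basis; case: (b =P b0) => [->|_]; case: (b' =P b0) => [->|_] //=.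
- by rewrite liexx rpred0 phi_ext0.
- by move=> _; apply: P_lie.
- move=> bge _; have [PS P0] := P_lie bge; rewrite lieC rpredN; split=> //.
  by rewrite -[- _]addr0 -scaleN1r phi_extP ?rpred0 // P0 phi_ext0 mulr0 addr0.
move=> bge b'ge; split; last by rewrite phi_ext_lie ?geS.
exact: loopvir_ge_lie_closed (geS _ bge) (geS _ b'ge).
Qed.

Theorem adjoin_functional : exists h : uea L -> K,
  [/\ forall c u v, h (c *: u + v) = c * h u + h v, h 1 = 1,
      forall u b, ge_letter N b -> h (u * uea_in (<< b >> : L)) = phi_ext phi << b >> * h u
    & forall u, h (u * uea_in P) = alpha * h u].
Proof.
have [x y Hx Hy z|x y Hx Hy|h [h_lin h1 hH]] := @character_functional K L _ int B adjoin_rank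
  adjoin_basis adjoin_coord adjoin_rank_inj adjoin_coord_basis adjoin_coordK
  adjoin_letter adjoin_char adjoin_rank_up.
- rewrite /basis_lie; have [S _] := adjoin_lie Hx Hy; rewrite /= (adjoin_coord_ge S).
  by rewrite -mcoeff_neq0 => /(ge_span_supp S) zge; rewrite /adjoin_letter zge orbT.
- by rewrite /basis_lie; have [S S0] := adjoin_lie Hx Hy; rewrite /= (adjoin_char_ge S).
exists h; split=> // [u b bge|u].
  have bH : adjoin_letter b by rewrite /adjoin_letter bge orbT.
  have := hH u b bH; rewrite /adjoin_basis /adjoin_char; case: eqP bge => // -> /P_ge[-> ->].
  by [].
have := hH u b0; rewrite /adjoin_letter /adjoin_basis /adjoin_char eqxx; exact.
Qed.

Theorem adjoin_whit : exists k : {additive W -> K},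
  k (whit_vec phi) = 1 /\ forall u, k ((u * (uea_in P - alpha%:A)) *: whit_vec phi) = 0.
Proof.
have [h [h_lin h1 h_ge hP]] := adjoin_functional.
have [k kE] := whit_functional h_lin h_ge.
exists k; split=> [|u]; first by rewrite -[whit_vec phi]scale1r kE.
rewrite kE mulrBr -scalerAr mulr1 -scaleN1r addrC scalerA mulN1r h_lin hP mulNr addNr.
by [].
Qed.

End Adjoin.

(** * A proper submodule when both coefficient sequences are recurrent *)

Lemma lie_suml (K : fieldType) (g : lieType K) (I : Type) (r : seq I) (c : I -> K) (x : I -> g) y :
  lie (\sum_(i <- r) c i *: x i) y = \sum_(i <- r) c i *: lie (x i) y.
Proof. by elim: r => [|i r IH]; rewrite ?big_nil ?lie0x // !big_cons lieDl IH. Qed.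

Lemma span_sum (K : fieldType) (V : lmodType K) (X : V -> Prop) (h : V -> K)
    (I : Type) (r : seq I) (c : I -> K) (x : I -> V) :
    h 0 = 0 -> (forall a y z, y \in Defs.span X -> z \in Defs.span X -> h (a *: y + z) = a * h y + h z) ->
    (forall i, x i \in Defs.span X) ->
  \sum_(i <- r) c i *: x i \in Defs.span X
  /\ h (\sum_(i <- r) c i *: x i) = \sum_(i <- r) c i * h (x i).
Proof.
move=> h0 hP xS; elim: r => [|i r [IH1 IH2]]; first by rewrite !big_nil rpred0.
by rewrite !big_cons hP // IH2 rpredD ?rpredZ.
Qed.

Section NotSimple.
Variables (K : numFieldType) (N : nat) (phi : {lie loopvir_ge K N -> K^o}).
Hypothesis N_gt0 : (0 < N)%N.
Local Notation L := (loopvir K).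
Local Notation B := (option int * int)%type.
Local Notation ge_span := (Defs.span (@loopvir_ge_gen K N)).
Local Notation W := (whittaker_module phi).
Local Notation v := (whit_vec phi).

Definition phi_dt (n k : int) : K := phi_ext phi (dt K n k).

Lemma whittaker_coef_dt n (N_le_n : N%:Z <= n) k :
  whittaker_coef phi N_le_n (tpow K k) = phi_dt n k.
Proof. by rewrite whittaker_coefE -phi_ext_incl. Qed.

Lemma vir_cocycle_neq i j : i + j != 0 -> vir_cocycle K i j = 0.
Proof. by rewrite /vir_cocycle -addr_eq0 => /negPf ->. Qed.

(** [d_n t^k] is, up to the nonzero factor [n - 2N], the bracket of [d_N] and
    [d_(n-N) t^k]. *)
Lemma phi_dt_gt n k : (2 * N)%N%:Z < n -> phi_dt n k = 0.
Proof.
move=> lt_n; have S1 : dt K N%:Z 0 \in ge_span by apply: dt_ge_span.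
have S2 : dt K (n - N%:Z) k \in ge_span by apply: dt_ge_span; lia.
have := phi_ext_lie phi S1 S2; rewrite lie_dtdt vir_cocycle_neq; last by apply/eqP; lia.
have -> : N%:Z + (n - N%:Z) = n by ring.
have S3 : dt K n k \in ge_span by apply: dt_ge_span; lia.
rewrite scale0r add0r phi_extP ?rpred0 // phi_ext0 addr0.
move/eqP; rewrite mulf_eq0 intr_eq0 => /orP[/eqP e|/eqP//].
by move: e lt_n; lia.
Qed.

(** Nothing is adjoined here: [c t^0] already belongs to the subalgebra. *)
Lemma whit_vec_neq0 : v != 0.
Proof.
have [|||k [kv _]] := @adjoin_whit K N phi (ct K 0) (None, 0) (phi_ext phi (ct K 0)).
- by rewrite /ct mcoeffUU.
- by [].
- move=> b _; have -> : lie (ct K 0) << b >> = 0.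
    by case: b => [[i|] k]; [exact: lie_ctdt | exact: lie_ctct].
  by rewrite rpred0 phi_ext0.
by apply: contra_eq_neq kv => ->; rewrite raddf0 eq_sym oner_eq0.
Qed.

Section Annihilator.
Variable p : {poly K}.
Hypothesis p_monic : p \is monic.
Hypothesis p2N : forall k, shiftp p (phi_dt (2 * N)%N%:Z) k = 0.
Hypothesis p2N1 : forall k, shiftp p (phi_dt ((2 * N)%N%:Z - 1)) k = 0.

Let P : L := \sum_(i < size p) p`_i *: dt K (N%:Z - 1) i%:Z.
Let b0 : B := (Some (N%:Z - 1), (size p).-1%:Z).

Lemma annihilator_coef : P@_b0 = 1.
Proof.
have szp : (0 < size p)%N by rewrite size_poly_gt0 monic_neq0.
have lt1 : ((size p).-1 < size p)%N by rewrite prednK.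
have E (r : seq 'I_(size p)) : (\sum_(j <- r) p`_j *: dt K (N%:Z - 1) j%:Z)@_b0
    = \sum_(j <- r) p`_j * (dt K (N%:Z - 1) j%:Z)@_b0.
  by elim: r => [|j r IH]; rewrite ?big_nil ?mcoeff0 // !big_cons mcoeffD IH mcoeffZ.
rewrite [LHS]E (bigD1 (Ordinal lt1)) //= mcoeffUU mulr1 big1 ?addr0.
  exact: (monicP p_monic).
move=> i /eqP ne; rewrite mcoeffU; case: eqP => [[e]|]; rewrite ?mulr0 //.
by case: ne; apply: val_inj.
Qed.

Lemma annihilator_lie b : ge_letter N b ->
  lie P << b >> \in ge_span /\ phi_ext phi (lie P << b >>) = 0.
Proof.
case: b => [[i|] k]; rewrite /ge_letter /= => bge.
  have S j : dt K (N%:Z - 1 + i) j \in ge_span by apply: dt_ge_span; lia.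
  have lieE (j : 'I_(size p)) : lie (dt K (N%:Z - 1) j%:Z) (dt K i k)
      = (i - (N%:Z - 1))%:~R *: dt K (N%:Z - 1 + i) (k + j%:Z).
    rewrite lie_dtdt vir_cocycle_neq; last by apply/eqP; lia.
    by rewrite scale0r addr0 [k + _]addrC.
  have -> : lie P << (Some i, k) >> = \sum_(j < size p)
      p`_j *: ((i - (N%:Z - 1))%:~R *: dt K (N%:Z - 1 + i) (k + j%:Z)).
    apply: etrans (lie_suml _ _ _ _) _; apply: eq_bigr => j _; congr (_ *: _).
    exact: lieE.
  have [||j|S1 S1E] := @span_sum K L (@loopvir_ge_gen K N) (phi_ext phi) _
    (index_enum 'I_(size p)) (fun j => p`_j) (fun j => (i - (N%:Z - 1))%:~R *: dt K (N%:Z - 1 + i) (k + j%:Z)).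
  - exact: phi_ext0.
  - by move=> a y z; apply: phi_extP.
  - by rewrite rpredZ.
  split; [exact: S1 | apply: etrans S1E _].
  transitivity ((i - (N%:Z - 1))%:~R * shiftp p (phi_dt (N%:Z - 1 + i)) k).
    rewrite /shiftp mulr_sumr; apply: eq_bigr => j _; rewrite mulrCA; congr (_ * _).
    rewrite -[X in phi_ext _ X]addr0 phi_extP ?rpred0 // phi_ext0 addr0.
    by [].
  suff -> : shiftp p (phi_dt (N%:Z - 1 + i)) k = 0 by rewrite mulr0.
  have [->|->|lt_2N] : [\/ N%:Z - 1 + i = (2 * N)%N%:Z, N%:Z - 1 + i = (2 * N)%N%:Z - 1
      | (2 * N)%N%:Z < N%:Z - 1 + i].
  - have : (N%:Z - 1 + i == (2 * N)%N%:Z) || (N%:Z - 1 + i == (2 * N)%N%:Z - 1)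
      || ((2 * N)%N%:Z < N%:Z - 1 + i) by lia.
    by case/orP => [/orP[]/eqP|]; [constructor 1 | constructor 2 | constructor 3].
  - exact: p2N.
  - exact: p2N1.
  by apply: shiftp_eq0 => m; apply: phi_dt_gt.
have -> : lie P << (None, k) >> = 0.
  apply: etrans (lie_suml _ _ _ _) _; apply: big1 => j _.
  have -> : lie (dt K (N%:Z - 1) j%:Z) << (None, k) >> = 0 by exact: lie_dtct.
  by rewrite scaler0.
by rewrite rpred0 phi_ext0.
Qed.

(** The vectors [w] with [k (U w) = 0] form a proper submodule that contains
    [(P - alpha) v]. *)
Lemma annihilator_not_simple : ~ simple_module W.
Proof.
move=> [_ simpleW].
have Pv alpha : (uea_in P - alpha%:A) *: v = 0.
  have [|||k [kv k0]] := @adjoin_whit K N phi P b0 alpha.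
  - exact: annihilator_coef.
  - by rewrite /ge_letter /= => le_N; exfalso; lia.
  - exact: annihilator_lie.
  pose S : {pred W} := fun w => `[< forall u, k (u *: w) = 0 >].
  have S_closed : submod_closed S.
    split; first by apply/asboolP => u; rewrite scaler0 raddf0.
    move=> a x y /asboolP Sx /asboolP Sy; apply/asboolP => u.
    rewrite scalerDr scalerA; apply: etrans (raddfD k _ _) _.
    by apply: etrans (congr2 +%R (Sx _) (Sy _)) (addr0 _).
  have [S0|ST] := simpleW S S_closed.
    have : (uea_in P - alpha%:A) *: v \in S by apply/asboolP => u; rewrite scalerA k0.
    by rewrite S0 inE => /eqP.
  have : v \in S by rewrite ST.
  by move=> /asboolP /(_ 1); rewrite scale1r kv => /eqP; rewrite oner_eq0.
have := Pv 0; rewrite scale0r subr0 => Pv0; have := Pv 1.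
rewrite scalerBl Pv0 sub0r !scale1r => /eqP; rewrite oppr_eq0.
by rewrite (negPf whit_vec_neq0).
Qed.

End Annihilator.

Theorem recurrent_not_simple : recurrent (phi_dt (2 * N)%N%:Z) ->
  recurrent (phi_dt ((2 * N)%N%:Z - 1)) -> ~ simple_module W.
Proof.
move=> r1 r2; have [p p0 pr] := recurrent_common r1 r2.
apply: (@annihilator_not_simple ((lead_coef p)^-1 *: p)).
- by apply/monicP; rewrite lead_coefZ mulVf // lead_coef_eq0.
- by move=> k; rewrite shiftpZ (pr k).1 mulr0.
by move=> k; rewrite shiftpZ (pr k).2 mulr0.
Qed.

End NotSimple.

(** * Weight filtration and symbols *)

Lemma cancel_step (V : zmodType) (d g p h q r : V) :
  d - g + (p - h + q) + (g + h - r) = d + (p + q) - r.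
Proof.
by rewrite [LHS](AC (2*(2*1)*3) (1*(3*5)*(2*6)*(4*7)*8)) /= !addNr !addr0.
Qed.

(** [A] stands for [U(L)], with [D n k] the image of [d_n t^k] and [C k] that of
    [c t^k]; the left ideal [I] is the annihilator of the Whittaker vector, on
    which [D n k] with [n >= N] acts by [f n k] and [C k] by [cc k]. *)
Section Filtration.
Variables (K : numFieldType) (A : algType K) (N s : int).
Hypotheses (N_gt0 : 0 < N) (s_ge : 2%:Z * N - 1 <= s).
Variables (D : int -> int -> A) (C : int -> A) (z : int -> int -> K).
Variables (f : int -> int -> K) (cc : int -> K).
Variable I : A -> Prop.
Hypothesis z_eq0 : forall i j, i + j != 0 -> z i j = 0.
Hypothesis DD : forall i k j l, D i k * D j l =
  D j l * D i k + ((j - i)%:~R *: D (i + j) (k + l) + z i j *: C (k + l)).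
Hypothesis DC : forall i k l, C l * D i k = D i k * C l.
Hypothesis I0 : I 0.
Hypothesis I_lin : forall c x y, I x -> I y -> I (c *: x + y).
Hypothesis I_mul : forall a x, I x -> I (a * x).
Hypothesis I_D : forall n k, N <= n -> I (D n k - (f n k)%:A).
Hypothesis I_C : forall k, I (C k - (cc k)%:A).

Local Notation letter := (int * int)%type.
Implicit Types (w : seq letter) (x y : letter) (u r : A).

Definition low x := x.1 < N.
Definition word w : A := \prod_(x <- w) D x.1 x.2.
Definition wt w : int := \sum_(x <- w) (s - x.1).

Lemma word_cons x w : word (x :: w) = D x.1 x.2 * word w.
Proof. by rewrite /word big_cons. Qed.

Lemma wt_cons x w : wt (x :: w) = s - x.1 + wt w.
Proof. by rewrite /wt big_cons. Qed.

Lemma wt_perm w w' : perm_eq w w' -> wt w = wt w'.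
Proof. by move=> ww'; apply: perm_big. Qed.

Lemma low_wt x : low x -> 1 <= s - x.1.
Proof. by rewrite /low; lia. Qed.

Lemma low_ge x : low x -> N <= s - x.1.
Proof. by rewrite /low; lia. Qed.

Lemma wt_ge w : all low w -> (size w)%:Z <= wt w.
Proof.
elim: w => [|x w IH] /=; first by rewrite /wt big_nil.
by move=> /andP[/low_wt lx /IH]; rewrite wt_cons; lia.
Qed.

Inductive Fil (k : int) : A -> Prop :=
| Fil_I u : I u -> Fil k u
| Fil_cons c w u : all low w -> wt w <= k -> Fil k u -> Fil k (c *: word w + u).

Lemma Fil0 k : Fil k 0. Proof. exact/Fil_I/I0. Qed.

Lemma Fil_lin k c u r : Fil k u -> Fil k r -> Fil k (c *: u + r).
Proof.
move=> Fu Fr; elim: Fu => [{}u Iu|c' w {}u lw wtw _ IH].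
  elim: Fr => [{}r Ir|c' w {}r lw wtw _ IH]; first exact/Fil_I/I_lin.
  by rewrite addrCA; apply: Fil_cons.
by rewrite scalerDr scalerA -addrA; apply: Fil_cons.
Qed.

Lemma FilD k u r : Fil k u -> Fil k r -> Fil k (u + r).
Proof. by move=> Fu Fr; rewrite -[u]scale1r; apply: Fil_lin. Qed.

Lemma FilZ k c u : Fil k u -> Fil k (c *: u).
Proof. by move=> Fu; rewrite -[c *: u]addr0; apply: Fil_lin Fu (Fil0 k). Qed.

Lemma Fil_sum k (T : eqType) (t : seq T) (c : T -> K) (g : T -> A) :
  (forall i, i \in t -> Fil k (g i)) -> Fil k (\sum_(i <- t) c i *: g i).
Proof.
elim: t => [|i t IH] Fg; first by rewrite big_nil; exact: Fil0.
rewrite big_cons; apply: Fil_lin; first by apply: Fg; rewrite mem_head.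
by apply: IH => j jt; apply: Fg; rewrite inE jt orbT.
Qed.

Lemma Fil_mono k k' u : k <= k' -> Fil k u -> Fil k' u.
Proof.
move=> kk'; elim=> [{}u Iu|c w {}u lw wtw _ IH]; first exact: Fil_I.
by apply: Fil_cons => //; apply: le_trans kk'.
Qed.

Lemma Fil_word k w : all low w -> wt w <= k -> Fil k (word w).
Proof. by move=> lw wtw; rewrite -[word w]scale1r -[_ *: _]addr0; apply: Fil_cons (Fil0 k). Qed.

Lemma Fil_neg k u : k < 0 -> Fil k u -> I u.
Proof.
move=> k0; elim=> // c w {}u /wt_ge lw wtw _ _; suff: false by [].
by move: lw wtw k0; move: (wt w); lia.
Qed.

Lemma Fil_low k x u : low x -> Fil k u -> Fil (k + (s - x.1)) (D x.1 x.2 * u).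
Proof.
move=> lx; elim=> [{}u Iu|c w {}u lw wtw _ IH]; first exact/Fil_I/I_mul.
rewrite mulrDr -scalerAr -word_cons; apply: Fil_cons => //=; first by rewrite lx.
by rewrite wt_cons; lia.
Qed.

Lemma C_word l w : C l * word w = word w * C l.
Proof.
elim: w => [|x w IH]; first by rewrite /word big_nil mulr1 mul1r.
by rewrite word_cons mulrA DC -mulrA IH mulrA.
Qed.

Lemma I_mulC l w : I (C l * word w - cc l *: word w).
Proof.
have -> : C l * word w - cc l *: word w = word w * (C l - (cc l)%:A).
  by rewrite mulrBr C_word -scalerAr mulr1.
exact/I_mul/I_C.
Qed.

Lemma Fil_C k l w : all low w -> wt w <= k -> Fil k (C l * word w).
Proof.
move=> lw wtw; rewrite -[C l * _](subrK (cc l *: word w)).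
by apply: FilD; [exact/Fil_I/I_mulC | exact/FilZ/Fil_word].
Qed.

Lemma I_word (E : A) (e : K) : I (E - e%:A) -> I (E * word [::] - e *: word [::]).
Proof. by rewrite /word big_nil mulr1. Qed.

Lemma commute_step (E E' Z : A) (a b e : K) x w :
    E * D x.1 x.2 = D x.1 x.2 * E + (a *: E' + b *: Z) ->
  E * word (x :: w) - e *: word (x :: w) =
    D x.1 x.2 * (E * word w - e *: word w) + (a *: (E' * word w) + b *: (Z * word w)).
Proof.
move=> EE'; rewrite word_cons mulrA EE' !mulrDl -!scalerAl -!mulrA mulrBr -scalerAr.
by rewrite addrAC.
Qed.

(** Moving [d_n] to the right end of a word either replaces a letter by one of
    smaller weight or removes letters. *)
Lemma Fil_D_sub n l w : N <= n -> all low w ->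
  Fil (wt w - 1) (D n l * word w - f n l *: word w).
Proof.
elim: w n l => [|x w IH] n l Nn /=; first by move=> _; exact/Fil_I/I_word/I_D.
move=> /andP[lx lw]; rewrite (commute_step _ _ (DD _ _ _ _)).
have wx := low_wt lx; apply: FilD; last apply: FilD; rewrite ?wt_cons.
- by apply: Fil_mono (Fil_low lx (IH n l Nn lw)); lia.
- apply: FilZ; case: (ltP (n + x.1) N) => [lt_N|le_N].
    by rewrite -(word_cons (_, _)); apply: Fil_word; rewrite /= ?lw ?wt_cons ?andbT //=; lia.
  rewrite -[D _ _ * _](subrK (f (n + x.1) (l + x.2) *: word w)).
  by apply: FilD; [apply: Fil_mono (IH _ _ le_N lw) | apply/FilZ/Fil_word]; rewrite //; lia.
by apply/FilZ/Fil_C => //; lia.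
Qed.

Lemma Fil_D n l w : N <= n -> all low w -> Fil (wt w) (D n l * word w).
Proof.
move=> Nn lw; rewrite -[D _ _ * _](subrK (f n l *: word w)).
apply: FilD; last exact/FilZ/Fil_word.
by apply: Fil_mono (Fil_D_sub l Nn lw); lia.
Qed.

Lemma word_swap x y w : low x -> low y -> all low w ->
  Fil (wt (x :: y :: w) - 1) (word (x :: y :: w) - word (y :: x :: w)).
Proof.
move=> lx ly lw; rewrite !word_cons !mulrA (DD x.1 x.2) mulrDl addrAC subrr add0r mulrDl -!scalerAl.
have wx := low_wt lx; have wy := low_wt ly.
rewrite !wt_cons; apply: FilD; apply: FilZ; last by apply: Fil_C => //; lia.
case: (ltP (x.1 + y.1) N) => [lt_N|le_N].
  by rewrite -(word_cons (_, _)); apply: Fil_word; rewrite /= ?lw ?wt_cons ?andbT //=; lia.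
by apply: Fil_mono (Fil_D _ le_N lw); lia.
Qed.

Lemma word_move x w1 w2 : low x -> all low (w1 ++ w2) ->
  Fil (wt (x :: w1 ++ w2) - 1) (word (x :: w1 ++ w2) - word (w1 ++ x :: w2)).
Proof.
move=> lx; elim: w1 => [|y w1 IH] /=; first by rewrite subrr => _; exact: Fil0.
move=> /andP[ly lw]; rewrite -[X in Fil _ (X - _)](subrK (word (y :: x :: w1 ++ w2))) -addrA.
apply: FilD; first exact: word_swap.
rewrite [word (y :: _)]word_cons [word (y :: _ ++ _)]word_cons -mulrBr.
by apply: Fil_mono (Fil_low ly (IH lw)); rewrite !wt_cons; lia.
Qed.

(** Modulo lower weight, words are commutative monomials. *)
Lemma word_perm w w' : all low w -> perm_eq w w' -> Fil (wt w - 1) (word w - word w').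
Proof.
elim: w w' => [|x w IH] w' lw ww'.
  by move: ww'; rewrite perm_sym => /perm_nilP ->; rewrite subrr; exact: Fil0.
have xw' : x \in w' by rewrite -(perm_mem ww') mem_head.
case/splitPr: xw' ww' => w1 w2 ww'; move: lw => /= /andP[lx lw].
have ww12 : perm_eq w (w1 ++ w2) by rewrite -(perm_cons x) (permPl ww') perm_catC /= perm_cons perm_catC.
have l12 : all low (w1 ++ w2) by rewrite -(perm_all _ ww12).
rewrite -[X in Fil _ (X - _)](subrK (word (x :: w1 ++ w2))) -addrA; apply: FilD.
  rewrite !word_cons -mulrBr; apply: Fil_mono (Fil_low lx (IH _ lw ww12)).
  by rewrite wt_cons; lia.
have -> : wt (x :: w) = wt (x :: w1 ++ w2) by apply: wt_perm; rewrite perm_cons.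
exact: word_move.
Qed.

(** [convD n m] is the image of [d_n q t^m].  The hypothesis on [q] makes it act
    by 0 on the Whittaker vector for [n > s], so that [d_n q] behaves as an
    operator of weight [s - n]. *)
Section Multiplier.
Variable q : {malg K[int]}.

Definition convD (n m : int) : A := lin_ext (fun r : int => D n (r + m)) q.
Definition convf (n m : int) : K := lin_form (fun r : int => f n (r + m)) q.
Let convC (m : int) : A := lin_ext (fun r : int => C (r + m)) q.
Let convc (m : int) : K := lin_form (fun r : int => cc (r + m)) q.

Hypothesis convf_gt : forall n m, s < n -> convf n m = 0.

Let convDD n m x : convD n m * D x.1 x.2 = D x.1 x.2 * convD n m
  + ((x.1 - n)%:~R *: convD (n + x.1) (m + x.2) + z n x.1 *: convC (m + x.2)).
Proof.
rewrite /convD /convC; elim/malg_ind: q => [|c r p IHp].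
  by rewrite !raddf0 mul0r mulr0 ?scaler0 !addr0.
rewrite !linearP /= !lin_extU mulrDl -scalerAl IHp DD mulrDr -scalerAr -!addrA !scalerDr !addrA.
by rewrite [LHS](ACl (1*4*2*5*3*6)).
Qed.

Let convD_I n m : N <= n -> I (convD n m - (convf n m)%:A).
Proof.
move=> Nn; rewrite /convD /convf; elim/malg_ind: q => [|c r p IHp].
  by rewrite raddf0 lin_form0 scale0r subr0; exact: I0.
rewrite linearP /= lin_extU lin_formP lin_formU scalerDl -scalerA opprD addrACA -scalerBr.
exact: I_lin (I_D _ Nn) IHp.
Qed.

Let convC_I m w : I (convC m * word w - convc m *: word w).
Proof.
rewrite /convC /convc; elim/malg_ind: q => [|c r p IHp].
  by rewrite raddf0 lin_form0 scale0r mul0r subr0; exact: I0.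
rewrite linearP /= lin_extU lin_formP lin_formU scalerDl -scalerA mulrDl -scalerAl opprD addrACA -scalerBr.
exact: I_lin (I_mulC _ _) IHp.
Qed.

Let Fil_convD_low n m k w : n < N -> all low w -> s - n + wt w <= k -> Fil k (convD n m * word w).
Proof.
move=> n_N lw le_k; rewrite /convD /lin_ext mulr_suml.
under eq_bigr => r _ do rewrite -scalerAl -(word_cons (_, _)).
apply: Fil_sum => r _; apply: Fil_word; first by rewrite /= lw andbT.
by rewrite wt_cons.
Qed.

Let Fil_convC m k w : all low w -> wt w <= k -> Fil k (convC m * word w).
Proof.
move=> lw le_k; rewrite -[convC m * _](subrK (convc m *: word w)).
by apply: FilD; [exact/Fil_I/convC_I | exact/FilZ/Fil_word].
Qed.

(** Commuting [d_n q] with a letter of index [i] gives [d_(n+i)], and the weight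
    drops by exactly [n] while [n + i < N]; for [n + i >= N] the bracket acts by
    a scalar that vanishes unless [n + i <= s]. *)
Lemma Fil_convD_word n m w : N <= n -> all low w ->
  Fil (wt w - n) (convD n m * word w - convf n m *: word w).
Proof.
elim: w n m => [|x w IH] n m Nn /=; first by move=> _; exact/Fil_I/I_word/convD_I.
move=> /andP[lx lw]; rewrite (commute_step _ _ (convDD _ _ _)).
have wx := low_wt lx; apply: FilD; last apply: FilD; rewrite ?wt_cons.
- by apply: Fil_mono (Fil_low lx (IH n m Nn lw)); lia.
- apply: FilZ; case: (ltP (n + x.1) N) => [lt_N|le_N].
    by apply: Fil_convD_low => //; lia.
  rewrite -[convD _ _ * _](subrK (convf (n + x.1) (m + x.2) *: word w)).
  apply: FilD; first by apply: Fil_mono (IH _ _ le_N lw); lia.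
  case: (ltP s (n + x.1)) => [lt_s|le_s]; first by rewrite convf_gt // scale0r; exact: Fil0.
  by apply/FilZ/Fil_word => //; lia.
case: (eqVneq (n + x.1) 0) => [e0|ne0]; last by rewrite z_eq0 // scale0r; exact: Fil0.
by apply/FilZ/Fil_convC => //; lia.
Qed.

Lemma Fil_convD n m k u : N <= n -> Fil k u -> Fil (k - n) (convD n m * u - convf n m *: u).
Proof.
move=> Nn; elim=> [{}u Iu|c w {}u lw wtw _ IH].
  apply: Fil_I; rewrite addrC -scaleNr; exact/I_lin/I_mul.
rewrite mulrDr -scalerAr scalerDr scalerA [convf n m * c]mulrC -scalerA opprD addrACA -scalerBr.
by apply: Fil_lin IH; apply: Fil_mono (Fil_convD_word m Nn lw); lia.
Qed.

Variable x0 : letter.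
Hypothesis low_x0 : low x0.

(** With [n = s - x0.1], a letter [x] contributes to the weight that is exactly
    [n] lower only through the scalar [f (n + x.1) (q t^x.2)].  If
    [x.1 > x0.1] this scalar is 0, and if [x.1 = x0.1] it is 1 or 0 according
    to whether [x = x0].  The operator is thus a multiple of the derivative in
    [x0]. *)
Lemma Fil_convD_min w : all low w -> all (fun x => x0.1 <= x.1) w ->
    (forall x, x \in w -> convf s x.2 = (x.2 == x0.2)%:R) ->
  Fil (wt w - (s - x0.1) - 1) (convD (s - x0.1) 0 * word w - convf (s - x0.1) 0 *: word w
    - ((2%:Z * x0.1 - s)%:~R * (count_mem x0 w)%:R) *: word (rem x0 w)).
Proof.
have Nn : N <= s - x0.1 by move: low_x0; rewrite /low; lia.
elim: w => [|x w IH] /=.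
  by move=> _ _ _; rewrite mulr0 scale0r subr0; exact/Fil_I/I_word/convD_I.
move=> /andP[lx lw] /andP[le_x le_w] fE; rewrite (commute_step _ _ (convDD _ _ _)) add0r.
have wx := low_wt lx.
have {}IH := IH lw le_w (fun y yw => fE y (mem_behead (s := x :: w) yw)).
set n := s - x0.1 in Nn IH *; set c := (_ - s)%:~R in IH *.
set Y := convD n 0 * word w - convf n 0 *: word w in IH *.
have Z_Fil : Fil (wt (x :: w) - n - 1) (z n x.1 *: (convC x.2 * word w)).
  case: (eqVneq (n + x.1) 0) => [e0|ne0]; last by rewrite z_eq0 // scale0r; exact: Fil0.
  by apply/FilZ/Fil_convC => //; rewrite wt_cons; lia.
have le_N : N <= n + x.1 by rewrite /n; lia.
have E_Fil : Fil (wt (x :: w) - n - 1)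
    (convD (n + x.1) x.2 * word w - convf (n + x.1) x.2 *: word w).
  by apply: Fil_mono (Fil_convD_word x.2 le_N lw); rewrite wt_cons; lia.
set F := (X in Fil _ X); have DY := Fil_low lx IH; rewrite mulrBr -scalerAr in DY.
have -> : F = (D x.1 x.2 * Y - (c * (count_mem x0 w)%:R) *: (D x.1 x.2 * word (rem x0 w)))
    + ((x.1 - n)%:~R *: (convD (n + x.1) x.2 * word w - convf (n + x.1) x.2 *: word w)
       + z n x.1 *: (convC x.2 * word w))
    + ((c * (count_mem x0 w)%:R) *: (D x.1 x.2 * word (rem x0 w))
       + ((x.1 - n)%:~R * convf (n + x.1) x.2) *: word w
       - (c * (count_mem x0 (x :: w))%:R) *: word (rem x0 (x :: w))).
  by rewrite /F scalerBr scalerA cancel_step.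
apply: FilD; first apply: FilD.
- by apply: Fil_mono DY; rewrite wt_cons; lia.
- by apply: FilD => //; apply: FilZ.
rewrite /=; case: (eqVneq x x0) => [xx0|xx0].
  have -> : n + x.1 = s by rewrite /n xx0 subrK.
  rewrite fE ?mem_head // xx0 eqxx mulr1.
  have -> : (x0.1 - n)%:~R = c by rewrite /c /n; congr (_%:~R); ring.
  rewrite natrD [X in c * (X + _)](_ : _ = 1) // mulrDr mulr1 scalerDl addrKA -scalerBr -word_cons.
  case: (boolP (x0 \in w)) => [x0w|/count_memPn ->]; last first.
    by rewrite mulr0 scale0r; exact: Fil0.
  have pw : perm_eq (x0 :: rem x0 w) w by rewrite perm_sym perm_to_rem.
  apply: FilZ; have -> : wt (x0 :: w) - n - 1 = wt (x0 :: rem x0 w) - 1.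
    by rewrite (wt_perm pw) wt_cons /n; ring.
  by apply: (word_perm _ pw); rewrite (perm_all _ pw).
rewrite add0n -word_cons [X in Fil _ X]addrAC subrr add0r.
suff -> : convf (n + x.1) x.2 = 0 by rewrite mulr0 scale0r; exact: Fil0.
case: (ltP s (n + x.1)) => [/convf_gt-> //|le_s].
have x1 : x.1 = x0.1 by move: le_s le_x; rewrite /n; lia.
have -> : n + x.1 = s by rewrite /n x1 subrK.
rewrite fE ?mem_head //; case: eqP => // x2; case/eqP: xx0.
by case: (x) (x0) x1 x2 => [? ?] [? ?] /= -> ->.
Qed.

End Multiplier.

(** [S] stands for the elements of [U(L)] that send the Whittaker vector into a
    given submodule. *)
Hypothesis dual : forall ks k0, uniq ks -> k0 \in ks -> exists q,
  (forall n m, s < n -> convf q n m = 0) /\ {in ks, forall l, convf q s l = (l == k0)%:R}.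
Variable S : A -> Prop.
Hypothesis S_lin : forall c u r, S u -> S r -> S (c *: u + r).
Hypothesis S_mul : forall a u, S u -> S (a * u).
Hypothesis S_I : forall u, I u -> S u.

Definition letter_le : rel letter := fun x y => (choice.pickle x <= choice.pickle y)%N.

Lemma letter_le_total : total letter_le. Proof. by move=> x y; apply: leq_total. Qed.
Lemma letter_le_trans : transitive letter_le. Proof. by move=> y x z'; apply: leq_trans. Qed.
Lemma letter_le_anti : antisymmetric letter_le.
Proof. by move=> x y; rewrite -eqn_leq => /eqP /(pcan_inj choice.pickleK). Qed.

(** Sorted words represent the commutative monomials of weight [k]. *)
Definition symbol_word k w := [&& all low w, sorted letter_le w & wt w == k].

Lemma min_letter (t : seq letter) x : x \in t ->
  exists2 x0, x0 \in t & forall y, y \in t -> x0.1 <= y.1.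
Proof.
elim: t x => // y t IH x _; case: t IH => [_|x1 t IH].
  by exists y => [|x2]; rewrite inE // => /eqP ->.
have [x0 x0t x0min] := IH x1 (mem_head _ _); case: (leP y.1 x0.1) => [le1|lt1].
  exists y; rewrite ?mem_head // => x2; rewrite inE => /predU1P[-> //|/x0min].
  exact: le_trans.
exists x0; first by rewrite inE x0t orbT.
by move=> x2; rewrite inE => /predU1P[->|/x0min //]; apply: ltW.
Qed.

Lemma rem_symbol k x0 w : x0 \in w -> symbol_word k w -> symbol_word (k - (s - x0.1)) (rem x0 w).
Proof.
move=> x0w /and3P[lw sw /eqP <-]; apply/and3P; split.
- by apply/allP => y /mem_rem yw; apply: (allP lw).
- exact: (subseq_sorted letter_le_trans (rem_subseq x0 w)).
by rewrite (wt_perm (perm_to_rem x0w)) wt_cons; apply/eqP; ring.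
Qed.

Lemma rem_symbol_inj k x0 w w' : x0 \in w -> x0 \in w' -> symbol_word k w -> symbol_word k w' ->
  rem x0 w = rem x0 w' -> w = w'.
Proof.
move=> x0w x0w' /and3P[_ sw _] /and3P[_ sw' _] e; apply: (sorted_eq letter_le_trans letter_le_anti) => //.
by rewrite (permPl (perm_to_rem x0w)) e perm_sym perm_to_rem.
Qed.

(** The derivative in [x0] of a symbol that involves [x0] is nonzero in
    characteristic 0, because removing one [x0] is injective on the monomials
    that contain it. *)
Lemma symbol_descent k (fs : {malg K[seq letter]}) r x0 w1 :
    {in msupp fs, forall w, symbol_word k w} -> Fil (k - 1) r -> S (lin_ext word fs + r) ->
    w1 \in msupp fs -> x0 \in w1 ->
    (forall w y, w \in msupp fs -> y \in w -> x0.1 <= y.1) ->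
  exists fs' r', [/\ fs' != 0, {in msupp fs', forall w, symbol_word (k - (s - x0.1)) w},
    Fil (k - (s - x0.1) - 1) r' & S (lin_ext word fs' + r')].
Proof.
move=> fsE Fr Su w1fs x0w1 x0min.
have low_x0 : low x0 by have /and3P[/allP lw _ _] := fsE _ w1fs; apply: lw.
pose ks := undup [seq y.2 | y <- flatten (msupp fs)].
have inks w y : w \in msupp fs -> y \in w -> y.2 \in ks.
  by move=> wfs yw; rewrite mem_undup map_f //; apply/flattenP; exists w.
have [q [q_gt qE]] := dual (undup_uniq _) (inks _ _ w1fs x0w1).
pose n := s - x0.1; pose c : K := (2%:Z * x0.1 - s)%:~R.
have Nn : N <= n by move: low_x0; rewrite /low /n; lia.
have c0 : c != 0 by rewrite intr_eq0; move: low_x0; rewrite /low; lia.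
pose G w : {malg K[seq letter]} := (c * (count_mem x0 w)%:R) *: << rem x0 w >>.
pose op u := convD q n 0 * u - convf q n 0 *: u.
pose r' := lin_ext (fun w => op (word w) - (c * (count_mem x0 w)%:R) *: word (rem x0 w)) fs + op r.
exists (lin_ext G fs), r'; split.
- apply/eqP => /(congr1 (mcoeff (rem x0 w1))) /eqP; rewrite mcoeff0 mcoeff_lin_ext.
  rewrite (bigD1_seq w1) ?fset_uniq //= big_seq_cond big1 ?addr0; last first.
    move=> w /andP[wfs ww1]; rewrite mcoeffZ mcoeffU.
    case: (rem x0 w =P _) => [e|_]; last by rewrite mulr0n !mulr0.
    case: (boolP (x0 \in w)) => [x0w|/count_memPn ->]; last by rewrite mulr0 mul0r mulr0.
    by case/eqP: ww1; apply: (rem_symbol_inj x0w x0w1 (fsE _ wfs) (fsE _ w1fs) e).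
  rewrite mcoeffZ mcoeffUU mulr1 !mulf_eq0 (negPf c0) pnatr_eq0 mcoeff_eq0 w1fs /=.
  by rewrite -leqn0 leqNgt -has_count has_pred1 x0w1.
- move=> w'; rewrite -mcoeff_neq0 mcoeff_lin_ext => nz.
  have [w [wfs x0w ->]] : exists w, [/\ w \in msupp fs, x0 \in w & w' = rem x0 w].
    apply: contrapT => no_w; case/eqP: nz; rewrite big_seq; apply: big1 => w wfs.
    rewrite mcoeffZ mcoeffU.
    case: (rem x0 w =P w') => [e|_]; last by rewrite mulr0n !mulr0.
    case: (boolP (x0 \in w)) => [x0w|/count_memPn ->]; last by rewrite mulr0 mul0r mulr0.
    by case: no_w; exists w.
  exact/rem_symbol/fsE.
- apply: FilD; last first.
    by apply: Fil_mono (Fil_convD q_gt 0 Nn Fr); rewrite /n; lia.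
  apply: Fil_sum => w wfs; have /and3P[lw _ /eqP <-] := fsE _ wfs.
  apply: (Fil_convD_min q_gt low_x0 lw); first by apply/allP => y; apply: x0min.
  by move=> y yw; apply/qE/(inks _ _ wfs yw).
have op_lin a u u' : op (a *: u + u') = a *: op u + op u'.
  rewrite /op mulrDr scalerDr -scalerAr scalerA [convf q n 0 * a]mulrC -scalerA opprD addrACA.
  by rewrite -scalerBr.
have -> : lin_ext word (lin_ext G fs) + r' = op (lin_ext word fs + r).
  rewrite /r' addrA -[X in op (X + _)]scale1r op_lin scale1r; congr (_ + _).
  have opE (t : seq (seq letter)) :
      op (\sum_(w <- t) fs@_w *: word w) = \sum_(w <- t) fs@_w *: op (word w).
    elim: t => [|w t IHt]; last by rewrite !big_cons op_lin IHt.
    by rewrite !big_nil /op mulr0 scaler0 subr0.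
  rewrite [op (lin_ext _ _)]opE lin_ext_comp /lin_ext -big_split; apply: eq_bigr => w _ /=.
  rewrite -scalerDr; congr (_ *: _).
  have -> : \sum_(b <- msupp (G w)) (G w)@_b *: word b = (c * (count_mem x0 w)%:R) *: word (rem x0 w).
    rewrite -[LHS]/(lin_ext word (G w)) /G linearZ_LR /=; congr (_ *: _).
    exact: lin_extU.
  by rewrite addrC subrK.
rewrite /op addrC -scaleNr; exact/S_lin/S_mul.
Qed.

(** Weights of words are nonnegative, so lowering the weight ends at the empty
    word, whose coefficient is the scalar sought. *)
Lemma symbol_reach1 k (fs : {malg K[seq letter]}) r : fs != 0 ->
    {in msupp fs, forall w, symbol_word k w} -> Fil (k - 1) r ->
  S (lin_ext word fs + r) -> S 1.
Proof.
have [b] := ubnP `|k|%N; elim: b k fs r => // b IH k fs r lt_b fs0 fsE Fr Su.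
have [w0 w0fs] : exists w, w \in msupp fs.
  apply: contrapT => no_w; case/eqP: fs0; apply/malgP => w.
  by rewrite mcoeff0 mcoeff_outdom //; apply/negP => wfs; case: no_w; exists w.
have k_ge0 w : w \in msupp fs -> (size w)%:Z <= k.
  by move=> /fsE /and3P[lw _ /eqP <-]; apply: wt_ge.
case: w0 w0fs => [|x w] w0fs.
  have k0 : k = 0 by have /and3P[_ _ /eqP <-] := fsE _ w0fs; rewrite /wt big_nil.
  have supp_nil : (msupp fs `<=` [fset [::]])%fset.
    by apply/fsubsetP => w /k_ge0; rewrite k0 inE; case: w.
  move: Su; rewrite (lin_extw _ supp_nil) big_seq_fset1 /word big_nil => Su.
  have Ir : I r by apply: Fil_neg Fr; rewrite k0.
  have c0 : fs@_[::] != 0 by rewrite mcoeff_neq0.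
  have := S_lin (fs@_[::])^-1 (S_lin (-1) (S_I Ir) Su) (S_I I0).
  by rewrite addr0 scaleN1r addrC addrK scalerA mulVf // scale1r.
have xt : x \in flatten (msupp fs : seq _).
  by apply/flattenP; exists (x :: w) => //; apply: mem_head.
have [x0 /flattenP[w1 w1fs x0w1] x0min] := min_letter xt.
have x0min' w' y : w' \in msupp fs -> y \in w' -> x0.1 <= y.1.
  by move=> w'fs yw'; apply: x0min; apply/flattenP; exists w'.
have [fs' [r' [fs'0 fs'E Fr' Su']]] := symbol_descent fsE Fr Su w1fs x0w1 x0min'.
apply: IH fs'0 fs'E Fr' Su'.
have /and3P[lw1 _ _] := fsE _ w1fs.
have low_x0 : low x0 by apply: (allP lw1).
have le_N := low_ge low_x0.
have rem_ge : (size (rem x0 w1))%:Z <= k - (s - x0.1).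
  have /and3P[lr _ /eqP <-] := rem_symbol x0w1 (fsE _ w1fs); exact: wt_ge.
by move: (s - x0.1) (size _) le_N N_gt0 rem_ge lt_b => n1 m1; lia.
Qed.

Lemma Fil_split k u : Fil k u -> exists fs r,
  [/\ u = lin_ext word fs + r, {in msupp fs, forall w, symbol_word k w} & Fil (k - 1) r].
Proof.
elim=> [{}u Iu|c w {}u lw wtw _ [fs [r [-> fsE Fr]]]].
  exists 0, u; split; [by rewrite raddf0 add0r | by move=> w; rewrite msupp0 | exact: Fil_I].
case: (ltgtP (wt w) k) wtw => // [lt_wk|wk] _.
  exists fs, (c *: word w + r); split=> //; first by rewrite addrCA.
  by apply: FilD Fr; apply/FilZ/Fil_word => //; lia.
have pw : perm_eq w (sort letter_le w) by rewrite perm_sym perm_sort.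
exists (c *: << sort letter_le w >> + fs), (c *: (word w - word (sort letter_le w)) + r); split.
- have -> : lin_ext word (c *: << sort letter_le w >> + fs) = c *: word (sort letter_le w) + lin_ext word fs.
    by rewrite linearP /= lin_extU.
  by rewrite scalerBr [RHS](AC (2*(2*1)) ((3*(2*5))*(1*4))) /= addrN addr0.
- move=> w'; rewrite -mcoeff_neq0 mcoeffD mcoeffZ mcoeffU.
  case: (sort letter_le w =P w') => [<- _|_]; last by rewrite mulr0 add0r mcoeff_neq0 => /fsE.
  apply/and3P; split; first by rewrite -(perm_all _ pw).
    exact: (sort_sorted letter_le_total).
  by rewrite -(wt_perm pw) wk.
by apply: FilD Fr; apply: FilZ; rewrite -wk; apply: word_perm.
Qed.

Lemma Fil_reach1 k u : Fil k u -> S u -> ~ I u -> S 1.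
Proof.
have [b] := ubnP `|(k + 1)%R|%N; elim: b k u => // b IH k u lt_b Fu Su Iu.
case: (ltP k 0) => [/Fil_neg/(_ Fu)//|k_ge0].
have [fs [r [uE fsE Fr]]] := Fil_split Fu; rewrite uE in Su Iu.
have [fs0|fs0] := eqVneq fs 0; last exact: (symbol_reach1 fs0 fsE Fr Su).
rewrite fs0 raddf0 add0r in Su Iu.
by apply: IH Fr Su Iu; move: lt_b; lia.
Qed.

Hypothesis A_ind : forall P : A -> Prop, P 0 -> P 1 -> (forall c u r, P u -> P r -> P (c *: u + r)) ->
  (forall n k u, P u -> P (D n k * u)) -> (forall k u, P u -> P (C k * u)) -> forall u, P u.

Lemma Fil_all u : exists k, Fil k u.
Proof.
have Fil_max k k' u' r' : Fil k u' -> Fil k' r' -> exists k0, Fil k0 u' /\ Fil k0 r'.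
  move=> Fu' Fr'; exists (Num.max k k').
  by split; [apply: Fil_mono Fu' | apply: Fil_mono Fr']; rewrite le_max lexx ?orbT.
have Fil_op (h : A -> A) : (forall c u r, h (c *: u + r) = c *: h u + h r) ->
    (forall u, I u -> I (h u)) ->
    (forall w, all low w -> exists k, Fil k (h (word w))) ->
  forall u', (exists k, Fil k u') -> exists k, Fil k (h u').
  move=> h_lin hI hw u' [k]; elim=> [{}u' Iu'|c w {}u' lw _ _ [k' Fu']].
    by exists 0; apply/Fil_I/hI.
  have [k1 F1] := hw w lw; have [k0 [F2 F3]] := Fil_max _ _ _ _ F1 Fu'.
  by exists k0; rewrite h_lin; apply: Fil_lin.
elim/A_ind: u => [||c u r [k Fu] [k' Fr]|n k u|k u].
- by exists 0; apply: Fil0.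
- exists 0; have -> : 1 = word [::] by rewrite /word big_nil.
  by apply: Fil_word => //; rewrite /wt big_nil.
- have [k0 [F1 F2]] := Fil_max _ _ _ _ Fu Fr.
  by exists k0; apply: Fil_lin.
- apply: Fil_op => [c u' r'|u'|w lw]; first by rewrite mulrDr -scalerAr.
    exact: I_mul.
  case: (ltP n N) => [n_N|N_n]; last by exists (wt w); apply: Fil_D.
  exists (wt w + (s - n)); apply: (@Fil_low _ (n, k)) => //.
  exact: Fil_word.
apply: Fil_op => [c u' r'|u'|w lw]; first by rewrite mulrDr -scalerAr.
  exact: I_mul.
by exists (wt w); apply: Fil_C.
Qed.

Theorem left_ideal_full u : S u -> ~ I u -> S 1.
Proof. by have [k Fu] := Fil_all u; apply: Fil_reach1 Fu. Qed.

End Filtration.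

(** * Simplicity when one coefficient sequence is not recurrent *)

Lemma scale_alg (K : fieldType) (A : lalgType K) (M : lmodType A) c (u : A) (w : M) :
  (c *: u) *: w = c%:A *: (u *: w).
Proof. by rewrite scalerA mulr_algl. Qed.

Section Simple.
Variables (K : numFieldType) (N : nat) (phi : {lie loopvir_ge K N -> K^o}).
Hypothesis N_gt0 : (0 < N)%N.
Local Notation L := (loopvir K).
Local Notation W := (whittaker_module phi).
Local Notation v := (whit_vec phi).

(** Evaluating [b] on the product of [q] with [p(t)] is evaluating the sequence
    [p . b] on [q]. *)
Lemma lin_form_shiftp (b : int -> K) (p : {poly K}) (q : {malg K[int]}) (m : int) :
  lin_form (fun r => b (r + m)) (lin_ext (fun j : int => \sum_(a < size p) p`_a *: << j + a%:Z >>) q)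
    = lin_form (fun j => shiftp p b (j + m)) q.
Proof.
have sumE (j : int) (t : seq 'I_(size p)) : lin_form (fun r => b (r + m)) (\sum_(a <- t) p`_a *: << j + a%:Z >>)
    = \sum_(a <- t) p`_a * b (j + m + a%:Z).
  elim: t => [|a t IH]; first by rewrite !big_nil lin_form0.
  by rewrite !big_cons lin_formP lin_formU IH -addrA [a%:Z + m]addrC addrA.
elim/malg_ind: q => [|c j q IHq]; first by rewrite raddf0 !lin_form0.
by rewrite linearP /= lin_extU !lin_formP lin_formU IHq [lin_form _ _]sumE.
Qed.

(** The multiples of [p(t)] are enough: [p . f s] is not recurrent when [f s] is
    not. *)
Lemma multiplier_dual (s : int) (p : {poly K}) : p != 0 ->
    (forall n m, s < n -> shiftp p (phi_dt phi n) m = 0) -> ~ recurrent (phi_dt phi s) ->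
  forall ks k0, uniq ks -> k0 \in ks -> exists q : {malg K[int]},
    (forall n m, s < n -> convf (phi_dt phi) q n m = 0)
    /\ {in ks, forall l, convf (phi_dt phi) q s l = (l == k0)%:R}.
Proof.
move=> p0 p_gt nrec ks k0 ks_uniq k0ks.
have nrec' : ~ recurrent (shiftp p (phi_dt phi s)) by move/(recurrent_shiftp p0).
have [q qE] := not_recurrent_dual nrec' ks_uniq k0ks.
exists (lin_ext (fun j : int => \sum_(a < size p) p`_a *: << j + a%:Z >>) q); split=> [n m lt_n|l lks].
  rewrite /convf lin_form_shiftp -[RHS](lin_form_const0 q); apply: eq_lin_form => j _; exact: p_gt.
by rewrite /convf lin_form_shiftp qE.
Qed.

Lemma uea_word_ind (P : uea L -> Prop) : P 0 -> P 1 ->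
    (forall c u r, P u -> P r -> P (c *: u + r)) ->
    (forall n k u, P u -> P (uea_in (dt K n k) * u)) -> (forall k u, P u -> P (uea_in (ct K k) * u)) ->
  forall u, P u.
Proof.
move=> P0 P1 P_lin Pd Pc; have [in_lin _] := @uea_in_rep K L.
have in0 := uea_in0 L.
have Pin (x : L) u : P u -> P (uea_in x * u).
  move=> Pu; elim/malg_ind: x => [|c b x IHx]; first by rewrite in0 mul0r.
  rewrite in_lin mulrDl -scalerAl; apply: P_lin => //.
  by case: b => [[n|] k]; [apply: Pd | apply: Pc].
elim/uea_ind => // c s u Pu; apply: P_lin => //.
elim: s => [|x s IH]; first by rewrite big_nil.
by rewrite big_cons; apply: Pin.
Qed.

Lemma whit_simple (s : int) (p : {poly K}) : 2%:Z * N%:Z - 1 <= s -> p != 0 ->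
    (forall n m, s < n -> shiftp p (phi_dt phi n) m = 0) -> ~ recurrent (phi_dt phi s) ->
  simple_module W.
Proof.
move=> s_ge p0 p_gt nrec; split; first by exists v; apply: whit_vec_neq0.
move=> S [S0 S_lin].
have S_scale (a : uea L) x : x \in S -> a *: x \in S.
  by move=> Sx; rewrite -[a *: x]addr0; apply: S_lin.
have algE c (u : uea L) (w : W) : (c *: u) *: w = c%:A *: (u *: w).
  exact: scale_alg.
have [in_lin in_lie] := @uea_in_rep K L.
have in0 := uea_in0 L.
have in_comm (x y : L) : uea_in x * uea_in y = uea_in y * uea_in x + uea_in (lie x y).
  by rewrite in_lie addrC subrK.
have in_lin2 a b (x y : L) : uea_in (a *: x + b *: y) = a *: uea_in x + b *: uea_in y.
  rewrite in_lin; congr (_ + _); apply: etrans (congr1 _ (esym (addr0 _))) _.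
  by rewrite in_lin in0 addr0.
case: (EM (exists2 w, w \in S & w != 0)) => [[w Sw w0]|no_w]; last first.
  left=> w; rewrite inE; apply/idP/eqP => [Sw|-> //].
  by apply/eqP; apply: contraT => w0; case: no_w; exists w.
right=> x; rewrite [RHS]inE /=.
have [u wE] := whit_vec_gen w; have [u' ->] := whit_vec_gen x.
suff : 1 *: v \in S by rewrite scale1r; apply: S_scale.
pose I (a : uea L) := a *: v = 0; pose S' (a : uea L) := a *: v \in S.
have N1 : 0 < N%:Z by lia.
apply: (@left_ideal_full K (uea L) N%:Z s N1 s_ge (fun n k => uea_in (dt K n k))
  (fun k => uea_in (ct K k)) (vir_cocycle K) (phi_dt phi) (fun k => phi_ext phi (ct K k))
  I _ _ _ _ _ _ _ _ (multiplier_dual p0 p_gt nrec) S' _ _ _ _ u).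
- exact: vir_cocycle_neq.
- move=> i k j l; apply: etrans (in_comm (dt K i k) (dt K j l)) _.
  by congr (_ + _); apply: etrans (congr1 _ (lie_dtdt _ _ _ _ _)) (in_lin2 _ _ _ _).
- move=> i k l; apply: etrans (in_comm (ct K l) (dt K i k)) _.
  by apply: etrans (congr1 _ (etrans (congr1 _ (lie_ctdt _ _ _ _)) in0)) (addr0 _).
- exact: scale0r.
- by move=> c a b Ia Ib; rewrite /I scalerDl algE Ia Ib scaler0 addr0.
- by move=> a b Ib; rewrite /I -scalerA Ib scaler0.
- move=> n k Nn; rewrite /I scalerBl (whit_vecE _ (dt_ge_span K k Nn)); exact: subrr.
- move=> k; rewrite /I scalerBl (whit_vecE _ (ct_ge_span K N k)); exact: subrr.
- move=> c a b Sa Sb.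
  have e := etrans (scalerDl v (c *: a) b) (congr1 (fun y => y + b *: v) (algE c a v)).
  rewrite /S' e; exact: (S_lin c%:A _ _ Sa Sb).
- by move=> a b Sb; rewrite /S' -scalerA; apply: S_scale.
- by move=> a Ia; rewrite /S' Ia.
- exact: uea_word_ind.
- by rewrite /S' -wE.
by rewrite /I -wE; apply/eqP.
Qed.

Theorem not_recurrent_simple :
  ~ recurrent (phi_dt phi (2 * N)%N%:Z) \/ ~ recurrent (phi_dt phi ((2 * N)%N%:Z - 1)) ->
  simple_module W.
Proof.
move=> nrec; have [rec2|nrec2] := EM (recurrent (phi_dt phi (2 * N)%N%:Z)); last first.
  apply: (@whit_simple (2 * N)%N%:Z 1 _ (oner_neq0 _) _ nrec2); first lia.
  by move=> n m lt_n; apply: shiftp_eq0 => k; apply: phi_dt_gt.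
have nrec1 : ~ recurrent (phi_dt phi ((2 * N)%N%:Z - 1)).
  by case: nrec => [/(_ rec2)|nrec1]; last exact: nrec1.
have [p p0 p2N] := rec2.
apply: (@whit_simple ((2 * N)%N%:Z - 1) p _ p0 _ nrec1); first lia.
move=> n m lt_n; case: (ltP (2 * N)%N%:Z n) => [gt_n|le_n].
  by apply: shiftp_eq0 => k; apply: phi_dt_gt.
have -> : n = (2 * N)%N%:Z by lia.
exact: p2N.
Qed.

End Simple.

(** * The simplicity criterion *)

Theorem theorem5p5 (R : realType) (N : nat) (N_gt0 : (0 < N)%N)
    (phi : {lie loopvir_ge R[i] N -> R[i]^o}) :
  simple_module (whittaker_module phi) <->
    ~ exp_polynomial (whittaker_coef phi (leN_double N)) \/
    ~ exp_polynomial (whittaker_coef phi (leN_double_pred N_gt0)).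
Proof.
have expE n (Nn : N%:Z <= n) :
    exp_polynomial (whittaker_coef phi Nn) <-> recurrent (phi_dt phi n).
  rewrite exp_polynomialE recurrent_exppoly.
  by split; apply: eq_exppoly => k; rewrite whittaker_coef_dt.
rewrite !expE; split; last exact: not_recurrent_simple.
move=> simpleW; apply/not_andP => -[rec2N rec2N1].
exact: (recurrent_not_simple N_gt0 rec2N rec2N1 simpleW).
Qed.
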